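(* In the linear model described in the context, suppose the support of $\mathsf P_0$ is contained in $[-M,M]$. Then there exist constants $\kappa,c_0>0$ depending only on $M$ such that if $(n/p)/\sigma^2<c_0$, then $\nabla^2\mathcal F_{\mathrm{TAP}}(m,s)\succeq\kappa\,I_{2p}$ for all $(m,s)\in\Gamma^p$.
   Context: Model: $y=X\beta_0+\varepsilon\in\mathbb R^n$, where $X\in\mathbb R^{n\times p}$, $\beta_0\in\mathbb R^p$, $\varepsilon\in\mathbb R^n$ are independent with i.i.d. entries $x_{ij}\sim N(0,1/p)$, $\beta_{0,j}\sim\mathsf P_0$, $\varepsilon_i\sim N(0,\sigma^2)$, $\sigma^2>0$. $\mathsf P_0$ is a probability law on $\mathbb R$ with compact support containing at least three distinct values. ($n,p\to\infty$ with $n/p\to\delta\in(0,\infty)$ and $(\sigma^2,\delta,\mathsf P_0)$ fixed.) Exponential family: for $(\lambda,\gamma)\in\mathbb R^2$ let $\mathsf P_{\lambda,\gamma}(d\beta)\propto e^{-(\gamma/2)\beta^2+\lambda\beta}\mathsf P_0(d\beta)$ and $\langle f(\beta)\rangle_{\lambda,\gamma}=\int f\,d\mathsf P_{\lambda,\gamma}$. $\Gamma=\{(\langle\beta\rangle_{\lambda,\gamma},\langle\beta^2\rangle_{\lambda,\gamma}):(\lambda,\gamma)\in\mathbb R^2\}$ (open, convex in $\mathbb R^2$); $(m,s)\in\Gamma^p$ means $(m_j,s_j)\in\Gamma$ for every $j$. Let $-\mathsf h(m,s)=\sup_{(\lambda,\gamma)\in\mathbb R^2}\{-\tfrac12\gamma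 s+\lambda m-\log\mathbb E_{\beta\sim\mathsf P_0}[e^{-(\gamma/2)\beta^2+\lambda\beta}]\}$. TAP free energy on $\Gamma^p$: with $D_0(m,s)=\sum_j-\mathsf h(m_j,s_j)$, $S(s)=\frac1p\sum_js_j$, $Q(m)=\frac1p\sum_jm_j^2$, $$\mathcal F_{\mathrm{TAP}}(m,s)=\tfrac n2\log2\pi\sigma^2+D_0(m,s)+\tfrac1{2\sigma^2}\|y-Xm\|_2^2+\tfrac n2\log\Big(1+\tfrac{S(s)-Q(m)}{\sigma^2}\Big).$$ $\nabla^2$ is the Hessian in $(m,s)\in\mathbb R^{2p}$. *)

(* Defs.v *)
From HB Require Import structures.
From mathcomp Require Import all_boot all_order all_algebra.
From mathcomp Require Import all_classical all_reals all_analysis.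
From mathcomp Require Import measurable_realfun.

Set Implicit Arguments.
Unset Strict Implicit.
Unset Printing Implicit Defensive.

Import Order.TTheory GRing.Theory Num.Theory.
Import numFieldNormedType.Exports.

Local Open Scope classical_set_scope.
Local Open Scope ring_scope.

Definition gradient (R : realType) N (F : 'rV[R]_N -> R) (z : 'rV[R]_N) :
  'rV[R]_N := \row_i 'D_(delta_mx 0 i) F z.

(* Entry (i, j) is the i-th partial derivative of the j-th partial
   derivative of F. *)
Definition hessian (R : realType) N (F : 'rV[R]_N -> R) (z : 'rV[R]_N) :
  'M[R]_N := 'J (gradient F) z.

(* ['D_v] and ['J] are total, with junk values where the derivative does not
   exist: [hessian F z] is only meaningful under this condition. *)
Definition twice_differentiable (R : realType) N (F : 'rV[R]_N -> R)
    (z : 'rV[R]_N) : Prop :=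
  (\forall w \near z, differentiable F w) /\ differentiable (gradient F) z.

Definition psd (R : realType) N (A : 'M[R]_N) : Prop :=
  A^T = A /\ forall v : 'rV[R]_N, 0 <= (v *m A *m v^T) 0 0.

Definition loewner_ge (R : realType) N (A B : 'M[R]_N) : Prop := psd (A - B).

(* The library norm on matrices is the sup norm, hence this definition. *)
Definition sqnorm2 (R : realType) n (v : 'cV[R]_n) : R := \sum_i v i 0 ^+ 2.

Definition msupport (R : realType)
    (mu : probability (measurableTypeR R) R) : set R :=
  [set x | forall U : set R, open U -> U x -> (0 < mu U)%E].

Definition mutually_independent d (T : measurableType d) (R : realType)
    (P : probability T R) (I : finType) (Z : I -> {RV P >-> R}) : Prop :=
  forall (J : {set I}) (B : I -> set R), (forall i, measurable (B i)) ->
  P (\bigcap_(i in [set` J]) (Z i @^-1` B i)) =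
  (\prod_(i in J) P (Z i @^-1` B i))%E.

(* Laws are compared on measurable sets only: the value of a measure on other
   sets is unspecified. *)
Definition has_law d (T : measurableType d) (R : realType)
    (P : probability T R) (Z : {RV P >-> R})
    (mu : set (measurableTypeR R) -> \bar R) : Prop :=
  forall A, measurable A -> distribution P Z A = mu A.

Section exponential_family.
Context {R : realType}.
Variable P0 : probability (measurableTypeR R) R.
Implicit Types lambda gamma m s b : R.

Definition tilt lambda gamma b : R :=
  expR (- (gamma / 2) * b ^+ 2 + lambda * b).

Lemma measurable_tilt lambda gamma :
  measurable_fun [set: measurableTypeR R] (tilt lambda gamma).
Proof.
apply: measurableT_comp => //=; apply: measurable_funD.
  by apply: measurable_funM => //; exact: measurable_realfun.measurable_funX.
exact: measurable_funM.
Qed.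

Definition tilted_measure lambda gamma (A : set (measurableTypeR R)) : \bar R :=
  (\int[P0]_(b in A) (tilt lambda gamma b)%:E)%E.

Section tilted_measure_is_measure.
Variables lambda gamma : R.

Let tilted0 : tilted_measure lambda gamma set0 = 0%E.
Proof. exact: integral_set0. Qed.

Let tilted_ge0 A : (0 <= tilted_measure lambda gamma A)%E.
Proof. by apply: integral_ge0 => b _; rewrite lee_fin expR_ge0. Qed.

Let tilted_sigma_additive : semi_sigma_additive (tilted_measure lambda gamma).
Proof.
apply: semi_sigma_additive_nng_induced => [|b]; last by rewrite lee_fin expR_ge0.
by apply/measurable_EFinP; exact: measurable_tilt.
Qed.

HB.instance Definition _ := isMeasure.Build _ _ _
  (tilted_measure lambda gamma) tilted0 tilted_ge0 tilted_sigma_additive.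

End tilted_measure_is_measure.

(* The second argument of [mnormalize] is a default, used only when the total
   mass is 0 or +oo; this does not happen when [P0] has compact support. *)
Definition expfam lambda gamma : probability (measurableTypeR R) R :=
  mnormalize (tilted_measure lambda gamma) P0.

Definition bracket (f : R -> R) lambda gamma : R :=
  \int[expfam lambda gamma]_b f b.

Definition Gamma : set (R * R) :=
  [set (bracket id lg.1 lg.2, bracket (fun b => b ^+ 2) lg.1 lg.2)
    | lg in [set: R * R]].

Definition entropy m s : \bar R :=
  (- ereal_sup [set (- (1 / 2) * lg.2 * s + lg.1 * m
                     - ln (\int[P0]_b tilt lg.1 lg.2 b)%R)%:E
               | lg in [set: R * R]])%E.

End exponential_family.

(* [normal_prob] takes the standard deviation as its second argument. *)
Record linear_model (R : realType)
    (P0 : probability (measurableTypeR R) R) (sigma2 : R) (n p : nat)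
    d (T : measurableType d) (P : probability T R)
    (x : 'I_n -> 'I_p -> {RV P >-> R}) (beta0 : 'I_p -> {RV P >-> R})
    (eps : 'I_n -> {RV P >-> R}) : Prop := {
  design_law : forall i j, has_law (x i j) (normal_prob 0 (Num.sqrt p%:R^-1));
  prior_law : forall j, has_law (beta0 j) P0;
  noise_law : forall i, has_law (eps i) (normal_prob 0 (Num.sqrt sigma2));
  model_indep : mutually_independent
    (fun k : 'I_n * 'I_p + 'I_p + 'I_n =>
       match k with
       | inl (inl ij) => x ij.1 ij.2
       | inl (inr j) => beta0 j
       | inr i => eps i
       end)
}.

Section realization.
Context {R : realType} {d} {T : measurableType d} {P : probability T R}.
Context {n p : nat}.
Variables (x : 'I_n -> 'I_p -> {RV P >-> R}) (beta0 : 'I_p -> {RV P >-> R}).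
Variable eps : 'I_n -> {RV P >-> R}.

Definition design (w : T) : 'M[R]_(n, p) := \matrix_(i, j) x i j w.

Definition response (w : T) : 'cV[R]_n :=
  design w *m (\col_j beta0 j w) + \col_i eps i w.

End realization.

Section TAP.
Context {R : realType}.
Variables (P0 : probability (measurableTypeR R) R) (sigma2 : R) (n p : nat).
Variables (X : 'M[R]_(n, p)) (y : 'cV[R]_n).

(* [entropy P0] is finite on [Gamma P0], so [fine] loses nothing there. *)
Definition D0 (m s : 'rV[R]_p) : R :=
  \sum_j fine (- entropy P0 (m 0%R j) (s 0%R j))%E.

Definition Smean (s : 'rV[R]_p) : R := p%:R^-1 * \sum_j s 0 j.

Definition Qmean (m : 'rV[R]_p) : R := p%:R^-1 * \sum_j m 0 j ^+ 2.

Definition FTAP (m s : 'rV[R]_p) : R :=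
  n%:R / 2 * ln (2 * pi * sigma2) + D0 m s
  + 1 / (2 * sigma2) * sqnorm2 (y - X *m m^T)
  + n%:R / 2 * ln (1 + (Smean s - Qmean m) / sigma2).

Definition FTAP_joint (z : 'rV[R]_(p + p)) : R := FTAP (lsubmx z) (rsubmx z).

End TAP.

(* Main.v *)
From HB Require Import structures.
Require Import Defs.
From mathcomp Require Import all_boot all_order all_algebra.
From mathcomp Require Import all_classical all_reals all_analysis.
From mathcomp Require Import measurable_realfun ring lra.
Import Order.TTheory GRing.Theory Num.Theory.
Import numFieldNormedType.Exports.
Local Open Scope classical_set_scope.
Local Open Scope ring_scope.

Set Implicit Arguments.
Unset Strict Implicit.
Unset Printing Implicit Defensive.

(** In the variables [a = lambda], [c = - gamma / 2], the function [- h] is the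
    convex conjugate of the log-partition function [phi] of [(b, b^2)] under the
    prior. Hence its gradient at [(m, s)] is the preimage of [(m, s)] under
    [grad phi], and its Hessian is the inverse of the covariance matrix [A] of
    [(b, b^2)]. All integrands are bounded, so every expansion needed for this
    comes with an explicit quadratic remainder obtained from
    [1 + u + u^2/4 <= e^u <= 1 + u + u^2]; no differentiation under the integral
    sign and no inverse function theorem is involved.

    In the Hessian of the free energy, the least-squares term is nonnegative, and
    the logarithm contributes, with [D = 1 + (S - Q) / sigma^2 >= 1],
    [- (n / (p sigma^2)) |u|^2 / D] and a negative rank-one term in
    [sum_j (v_j - 2 m_j u_j)]. Since [Var (b^2 - 2 m b) <= 4 M^2 Var b],
    Cauchy-Schwarz for [A] and its inverse absorbs the latter into the entropy
    term, which dominates [|(u, v)|^2 / tr A] with [tr A <= M^2 + M^4]. *)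

(** * Means of bounded variables *)

Section exponential_bounds.
Context {R : realType}.
Implicit Types u z : R.

(** Square of [1 + u/2 <= e^(u/2)], whose left side is nonnegative for [u >= -2]. *)
Lemma expR_ge_quad u : - 2 <= u -> 1 + u + u ^+ 2 / 4 <= expR u.
Proof.
move=> u2; have e : expR u = expR (u / 2) ^+ 2.
  by rewrite -expRM_natl; congr expR; lra.
have := @expR_ge1Dx R (u / 2); rewrite e; nra.
Qed.

(** The quadratic lower bound at [- u] suffices, since [(1 + u + u^2)(1 - u + u^2/4) >= 1] on this
    range. *)
Lemma expR_le_quad u : `|u| <= 1 / 4 -> expR u <= 1 + u + u ^+ 2.
Proof.
rewrite ler_norml => /andP[u1 u2].
have h : 1 - u + u ^+ 2 / 4 <= expR (- u).
  by have := @expR_ge_quad (- u); rewrite sqrrN; apply; lra.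
have e : expR u * expR (- u) = 1 by rewrite -expRD subrr expR0.
have e0 := expR_gt0 u.
rewrite -(ler_pM2r (expR_gt0 (- u))) e.
have p : 0 <= 1 + u + u ^+ 2 by nra.
apply: le_trans (ler_wpM2l p h); nra.
Qed.

Lemma ln1D_ge_half z : 0 <= z <= 1 / 2 -> z / 2 <= ln (1 + z).
Proof.
move=> /andP[z0 z1]; rewrite -ler_expR lnK; last by rewrite posrE; lra.
by apply: (le_trans (expR_le_quad _)); [rewrite ger0_norm; lra|nra].
Qed.

End exponential_bounds.

(** * Continuous functions on the line *)

Section continuity.
Context {R : realType}.
Implicit Types f g : R -> R.

(* Hides the filters behind a constant, so that [cont] is driven by syntax. *)
Definition cts f : Prop := continuous f.

Lemma cts_add f g : cts f -> cts g -> cts (fun b => f b + g b).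
Proof. by move=> cf cg x; apply: cvgD; [exact: cf|exact: cg]. Qed.

Lemma cts_opp f : cts f -> cts (fun b => - f b).
Proof. by move=> cf x; apply: cvgN; exact: cf. Qed.

Lemma cts_mul f g : cts f -> cts g -> cts (fun b => f b * g b).
Proof. by move=> cf cg x; apply: cvgM; [exact: cf|exact: cg]. Qed.

Lemma cts_expn f n : cts f -> cts (fun b => f b ^+ n).
Proof.
move=> cf x; apply: (@continuous_comp _ _ _ f (fun y => y ^+ n)); first exact: cf.
exact: exprn_continuous.
Qed.

Lemma cts_exp f : cts f -> cts (fun b => expR (f b)).
Proof.
move=> cf x; apply: (@continuous_comp _ _ _ f expR); first exact: cf.
exact: continuous_expR.
Qed.

Lemma cts_cst (k : R) : cts (fun=> k).
Proof. exact: cst_continuous. Qed.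

Lemma cts_id : cts (fun b => b).
Proof. by move=> x; exact: cvg_id. Qed.

End continuity.

Ltac cont := lazymatch goal with
  | |- cts (fun b => b) => exact (@cts_id _)
  | |- cts (fun _ => ?k) => exact (@cts_cst _ k)
  | |- cts (fun b => @?f b + @?g b) => apply: (@cts_add _ f g); cont
  | |- cts (fun b => - @?f b) => apply: (@cts_opp _ f); cont
  | |- cts (fun b => @?f b * @?g b) => apply: (@cts_mul _ f g); cont
  | |- cts (fun b => @?f b ^+ ?n) => apply: (@cts_expn _ f n); cont
  | |- cts (fun b => expR (@?f b)) => apply: (@cts_exp _ f); cont
  | |- cts ( *%R ?k) => apply: (@cts_mul _ (fun=> k) (fun b => b)); cont
  | |- cts _ => assumption
  end.

(* Positive normalized functionals on the continuous functions: the means of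
   probability measures concentrated on [-M, M] with support containing [S]. *)
Record mean (R : realType) (M : R) (S : set R) (E : (R -> R) -> R) : Prop := {
  meanD : forall f g : R -> R, cts f -> cts g ->
    E (fun b => f b + g b) = E f + E g;
  meanZ : forall (k : R) (f : R -> R), cts f -> E (fun b => k * f b) = k * E f;
  mean_ge0 : forall f : R -> R, cts f -> (forall b, `|b| <= M -> 0 <= f b) -> 0 <= E f;
  mean_gt0 : forall (f : R -> R) a, cts f -> (forall b, `|b| <= M -> 0 <= f b) ->
    S a -> 0 < f a -> 0 < E f;
  mean1 : E (fun=> 1) = 1
}.

(** * Moments of [b] and [b^2] and their covariance matrix *)

Section mean_theory.
Context {R : realType} (M : R) (S : set R) (E : (R -> R) -> R).
Hypothesis mE : mean M S E.
Implicit Types (f g : R -> R) (k : R).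

Lemma mean_cst k : E (fun=> k) = k.
Proof.
transitivity (E (fun=> k * 1)).
  by congr (E _); apply/funext => b; rewrite mulr1.
by rewrite (meanZ mE) ?(mean1 mE) ?mulr1 //; exact: cts_cst.
Qed.

Lemma meanB f g : cts f -> cts g ->
  E (fun b => f b - g b) = E f - E g.
Proof.
move=> cf cg; rewrite -[- E g]mulN1r -(meanZ mE)// -(meanD mE)//; last by cont.
by congr (E _); apply/funext => b; rewrite mulN1r.
Qed.

Lemma le_mean f g : cts f -> cts g ->
  (forall b, `|b| <= M -> f b <= g b) -> E f <= E g.
Proof.
move=> cf cg fg; rewrite -subr_ge0 -meanB//; apply: (mean_ge0 mE); first by cont.
by move=> b /fg; rewrite subr_ge0.
Qed.

Lemma mean_norm_le f k : cts f -> (forall b, `|b| <= M -> `|f b| <= k) ->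
  `|E f| <= k.
Proof.
move=> cf fk; rewrite ler_norml; apply/andP; split.
  by rewrite -(mean_cst (- k)); apply: le_mean => //; [cont|];
    move=> b /fk; rewrite ler_norml => /andP[].
by rewrite -[leRHS]mean_cst; apply: le_mean => //; [cont|];
  move=> b /fk; rewrite ler_norml => /andP[].
Qed.

(** For negative [M] the positivity condition is vacuous and would give [E (-1) >= 0], against
    normalization. *)
Lemma mean_Mge0 : 0 <= M.
Proof.
rewrite leNgt; apply/negP => M0.
have : (0 : R) <= - 1.
  rewrite -(mean_cst (- 1)); apply: (mean_ge0 mE); first by cont.
  by move=> b bM; have := le_lt_trans bM M0; rewrite normr_lt0.
by lra.
Qed.

(** The mean of [e^(f - E f) >= 1 + (f - E f)] is taken; the right side has mean 1. *)
Lemma mean_jensen f : cts f -> expR (E f) <= E (fun b => expR (f b)).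
Proof.
move=> cf.
have -> : E (fun b => expR (f b)) = E (fun b => expR (E f) * expR (f b - E f)).
  by congr (E _); apply/funext => b; rewrite -expRD addrC subrK.
rewrite (meanZ mE); last by cont.
rewrite ler_peMr ?expR_ge0//.
have <- : E (fun b => 1 + (f b - E f)) = 1.
  rewrite (meanD mE) ?(mean1 mE) ?meanB ?mean_cst; try by cont.
  by rewrite subrr addr0.
by apply: le_mean; [cont..|move=> b _; exact: expR_ge1Dx].
Qed.

Let m := E (fun b => b).
Let s := E (fun b => b ^+ 2).

Definition cov11 := E (fun b => (b - m) ^+ 2).
Definition cov12 := E (fun b => (b - m) * (b ^+ 2 - s)).
Definition cov22 := E (fun b => (b ^+ 2 - s) ^+ 2).
Definition covdet := cov11 * cov22 - cov12 ^+ 2.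

Local Notation u h1 h2 := (fun b => h1 * (b - m) + h2 * (b ^+ 2 - s)).

Lemma meanM_u (f : R -> R) h1 h2 : cts f ->
  E (fun b => f b * (u h1 h2 b)) =
  h1 * E (fun b => f b * (b - m)) + h2 * E (fun b => f b * (b ^+ 2 - s)).
Proof.
move=> cf; rewrite -!(meanZ mE) -?(meanD mE); try by cont.
by congr (E _); apply/funext => b; ring.
Qed.

Lemma mean_u h1 h2 : E (u h1 h2) = 0.
Proof.
rewrite (meanD mE) ?(meanZ mE) ?meanB ?mean_cst; try by cont.
by rewrite !subrr !mulr0 addr0.
Qed.

(** The covariance form, that is, the variance of [h1 b + h2 b^2]. *)
Definition covq h1 h2 := h1 ^+ 2 * cov11 + 2 * h1 * h2 * cov12 + h2 ^+ 2 * cov22.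

Lemma mean_u2 h1 h2 : E (fun b => u h1 h2 b ^+ 2) = covq h1 h2.
Proof.
rewrite /covq /cov11 /cov12 /cov22 -!(meanZ mE) -?(meanD mE); try by cont.
by congr (E _); apply/funext => b; ring.
Qed.

Lemma cov11E : cov11 = s - m ^+ 2.
Proof.
transitivity (E (fun b => b ^+ 2 - 2 * m * b + m ^+ 2)).
  by congr (E _); apply/funext => b; ring.
rewrite (meanD mE) ?meanB ?(meanZ mE) ?mean_cst; try by cont.
by rewrite -/m -/s; ring.
Qed.

Lemma cov11_le : cov11 <= M ^+ 2.
Proof.
rewrite cov11E; apply: (@le_trans _ _ s); first by have := sqr_ge0 m; lra.
rewrite -[leRHS]mean_cst; apply: le_mean; [cont..|].
by move=> b bM; rewrite -real_normK ?num_real// ler_sqr ?nnegrE// mean_Mge0.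
Qed.

Lemma cov22_le : cov22 <= M ^+ 4.
Proof.
have -> : cov22 = E (fun b => b ^+ 4) - s ^+ 2.
  transitivity (E (fun b => b ^+ 4 - 2 * s * b ^+ 2 + s ^+ 2)).
    by congr (E _); apply/funext => b; ring.
  rewrite (meanD mE) ?meanB ?(meanZ mE) ?mean_cst; try by cont.
  by rewrite -/m -/s; ring.
apply: (@le_trans _ _ (E (fun b => b ^+ 4))); first by have := sqr_ge0 s; lra.
rewrite -[leRHS]mean_cst; apply: le_mean; [cont..|].
move=> b bM; rewrite -[leLHS]ger0_norm; last by rewrite (exprM b 2 2) sqr_ge0.
by rewrite normrX; apply: lerXn2r; rewrite ?nnegrE// mean_Mge0.
Qed.

Lemma mean_norm_m : `|m| <= M. Proof. by apply: mean_norm_le => //; cont. Qed.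

(* Here [(b - m)^2 - Var] is [u (- 2 * m) 1]: the variance of [(b - m)^2] is at
   most its second moment. *)
Lemma covq_var_le : covq (- 2 * m) 1 <= 4 * M ^+ 2 * cov11.
Proof.
rewrite -mean_u2.
have -> : E (fun b => u (- 2 * m) 1 b ^+ 2) =
    E (fun b => (b - m) ^+ 4) - cov11 ^+ 2.
  transitivity (E (fun b => (b - m) ^+ 4 - 2 * cov11 * (b - m) ^+ 2 + cov11 ^+ 2)).
    by congr (E _); apply/funext => b; rewrite cov11E; ring.
  rewrite (meanD mE) ?meanB ?(meanZ mE) ?mean_cst; try by cont.
  by rewrite -/cov11; ring.
rewrite -(meanZ mE); last by cont.
apply: (@le_trans _ _ (E (fun b => (b - m) ^+ 4))).
  by have := sqr_ge0 cov11; lra.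
apply: le_mean; [cont..|move=> b bM].
(* One factor [(b - m)^2] is kept; the other is at most [(2 M)^2], as [|b|] and [|m|] are at most
   [M]. *)
rewrite (exprD _ 2 2); apply: ler_wpM2r; first exact: sqr_ge0.
have -> : 4 * M ^+ 2 = (2 * M) ^+ 2 by ring.
rewrite -real_normK ?num_real// ler_sqr ?nnegrE ?mulr_ge0 ?mean_Mge0//.
by have := ler_normB b m; have := mean_norm_m; lra.
Qed.

Hypothesis three_points : exists a b c, S a /\ S b /\ S c /\
  a <> b /\ a <> c /\ b <> c.

(** A nonzero polynomial of degree at most two cannot vanish at three distinct points, so the
    centered combination is nonzero somewhere on [S]. *)
Lemma covq_gt0 h1 h2 : (h1 != 0) || (h2 != 0) -> 0 < covq h1 h2.
Proof.
move=> h0; rewrite -mean_u2; case: three_points => a [b [c [Sa [Sb [Sc [ab [ac bc]]]]]]].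
have [x Sx ux] : exists2 x, S x & u h1 h2 x != 0.
  apply: contrapT => /forall2NP H.
  have {}H x : S x -> u h1 h2 x = 0.
    by move=> Sx; case: (H x) => // /negP; rewrite negbK => /eqP.
  (* Difference of the equations at two points, divided by the difference of the points. *)
  have H1 : h1 + h2 * (a + b) = 0.
    apply: (mulIf (_ : a - b != 0)); first by rewrite subr_eq0; apply/eqP.
    by rewrite mul0r -(subrr 0) -{1}(H a Sa) -(H b Sb); ring.
  have H2 : h1 + h2 * (a + c) = 0.
    apply: (mulIf (_ : a - c != 0)); first by rewrite subr_eq0; apply/eqP.
    by rewrite mul0r -(subrr 0) -{1}(H a Sa) -(H c Sc); ring.
  have h20 : h2 = 0.
    apply: (mulIf (_ : b - c != 0)); first by rewrite subr_eq0; apply/eqP.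
    by rewrite mul0r -(subrr 0) -{1}H1 -H2; ring.
  by move: h0 H1; rewrite h20 mul0r addr0 eqxx orbF => /eqP.
apply: (mean_gt0 mE (a := x)) => //; first by cont.
  by move=> y _; exact: sqr_ge0.
by rewrite lt_neqAle sqr_ge0 andbT eq_sym expf_eq0.
Qed.

Lemma cov11_gt0 : 0 < cov11.
Proof. by have := @covq_gt0 1 0; rewrite /covq oner_neq0 => /(_ isT); lra. Qed.

Lemma cov22_gt0 : 0 < cov22.
Proof. by have := @covq_gt0 0 1; rewrite /covq oner_neq0 orbT => /(_ isT); lra. Qed.

(** The form at the vector [(- cov12, cov11)] equals [cov11] times the determinant. *)
Lemma covdet_gt0 : 0 < covdet.
Proof.
have c1 := cov11_gt0.
rewrite -(pmulr_rgt0 _ c1).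
have -> : cov11 * covdet = covq (- cov12) cov11 by rewrite /covq /covdet; ring.
by apply: covq_gt0; rewrite (gt_eqF c1) orbT.
Qed.

(** By Cayley-Hamilton, [(tr A) A - (det A) I = A^2], so the difference of the two sides is
    [|A h|^2 / tr A]. *)
Lemma covq_coercive h1 h2 :
  covdet / (cov11 + cov22) * (h1 ^+ 2 + h2 ^+ 2) <= covq h1 h2.
Proof.
have tr0 : 0 < cov11 + cov22 by have := cov11_gt0; have := cov22_gt0; lra.
rewrite mulrAC ler_pdivrMr// -subr_ge0.
have -> : covq h1 h2 * (cov11 + cov22) - covdet * (h1 ^+ 2 + h2 ^+ 2) =
   (cov11 * h1 + cov12 * h2) ^+ 2 + (cov12 * h1 + cov22 * h2) ^+ 2.
  by rewrite /covq /covdet; ring.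
by rewrite addr_ge0 ?sqr_ge0.
Qed.

End mean_theory.

(** * Exponential tilting *)

(* The weight [tilt] of the exponential family, with [c] for [- gamma / 2]. *)
Definition quadexp (R : realType) (a c b : R) : R := expR (a * b + c * b ^+ 2).

(** Defined on functionals rather than on measures, so that tilting can be iterated. *)
Definition tilted (R : realType) (E : (R -> R) -> R) (a c : R) (f : R -> R) : R :=
  E (fun b => f b * quadexp a c b) / E (quadexp a c).

Section tilting.
Context {R : realType} (M : R) (S : set R) (E : (R -> R) -> R).
Hypothesis mE : mean M S E.
Implicit Types (f : R -> R) (a c : R).

Lemma cts_quadexp a c : cts (quadexp a c).
Proof. by rewrite /quadexp; cont. Qed.

Lemma cts_mul_quadexp f a c : cts f -> cts (fun b => f b * quadexp a c b).
Proof. by move=> cf; rewrite /quadexp; cont. Qed.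

Lemma mean_quadexp_gt0 a c : 0 < E (quadexp a c).
Proof. by apply: lt_le_trans (mean_jensen mE _); rewrite ?expR_gt0//; cont. Qed.

(** The weight is continuous and positive, so [M] and [S] are unchanged. Estimates at the origin
    thereby apply at every parameter. *)
Lemma mean_tilted a c : mean M S (tilted E a c).
Proof.
have Z0 := mean_quadexp_gt0 a c.
split.
- move=> f g cf cg; rewrite /tilted -mulrDl -(meanD mE); try exact: cts_mul_quadexp.
  by congr (E _ / _); apply/funext => b; rewrite mulrDl.
- move=> k f cf; rewrite /tilted mulrA -(meanZ mE); last exact: cts_mul_quadexp.
  by congr (E _ / _); apply/funext => b; rewrite mulrA.
- move=> f cf f0; rewrite divr_ge0 ?(ltW Z0)//.
  apply: (mean_ge0 mE); first exact: cts_mul_quadexp.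
  by move=> b /f0 fb; rewrite mulr_ge0 ?expR_ge0.
- move=> f x cf f0 Sx fx; rewrite divr_gt0//.
  apply: (mean_gt0 mE (a := x)) => //; first exact: cts_mul_quadexp.
    by move=> b /f0 fb; rewrite mulr_ge0 ?expR_ge0.
  by rewrite mulr_gt0 ?expR_gt0.
- rewrite /tilted.
  have -> : (fun b => 1 * quadexp a c b) = quadexp a c.
    by apply/funext => b; rewrite mul1r.
  by rewrite divff ?gt_eqF.
Qed.

Lemma quadexpD a c h1 h2 b :
  quadexp (a + h1) (c + h2) b = quadexp h1 h2 b * quadexp a c b.
Proof. by rewrite /quadexp -expRD; congr expR; ring. Qed.

(** Parameters of successive tilts add: an expansion at [(a, c)] is an expansion at the origin for
    the tilted mean. *)
Lemma tilted_tilted a c h1 h2 f :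
  tilted (tilted E a c) h1 h2 f = tilted E (a + h1) (c + h2) f.
Proof.
rewrite /tilted invfM invrK mulrACA mulVf ?mulr1 ?gt_eqF ?mean_quadexp_gt0//.
congr (_ / _); last congr (E _).
  by congr (E _); apply/funext => b; rewrite quadexpD mulrA.
by apply/funext => b; rewrite quadexpD.
Qed.

Lemma ln_tilted_quadexp a c h1 h2 :
  ln (tilted E a c (quadexp h1 h2)) =
  ln (E (quadexp (a + h1) (c + h2))) - ln (E (quadexp a c)).
Proof.
rewrite /tilted ln_div ?posrE ?mean_quadexp_gt0//; last first.
  have -> : (fun b => quadexp h1 h2 b * quadexp a c b) = quadexp (a + h1) (c + h2).
    by apply/funext => b; rewrite quadexpD.
  exact: mean_quadexp_gt0.
congr (ln (E _) - _); apply/funext => b; by rewrite quadexpD.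
Qed.

End tilting.

(** * Expansions of the log-partition function and of the tilted means at the origin *)

Section local_estimates.
Context {R : realType} (M : R) (S : set R) (E : (R -> R) -> R).
Hypothesis mE : mean M S E.
Implicit Type f : R -> R.

Let m := E (fun b => b).
Let s := E (fun b => b ^+ 2).
(** Bounds both [|b - m| <= 2 M] and [|b^2 - s| <= 2 M^2]; the summand 1 gives [1 <= K]. *)
Let K : R := 1 + 2 * M + 2 * M ^+ 2.
Let u (h1 h2 b : R) : R := h1 * (b - m) + h2 * (b ^+ 2 - s).

Let M0 : 0 <= M. Proof. exact: mean_Mge0 mE. Qed.

Let K1 : 1 <= K. Proof. by rewrite /K; have := sqr_ge0 M; have := M0; lra. Qed.

Let le_center1 b : `|b| <= M -> `|b - m| <= K.
Proof.
move=> bM; have := ler_normB b m; have := mean_norm_m mE; rewrite -/m /K.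
by have := sqr_ge0 M; have := M0; lra.
Qed.

Let le_center2 b : `|b| <= M -> `|b ^+ 2 - s| <= K.
Proof.
have sq x : `|x| <= M -> `|x ^+ 2| <= M ^+ 2.
  by move=> xM; rewrite normrX ler_sqr ?nnegrE.
move=> bM; have := ler_normB (b ^+ 2) s; have := sq _ bM.
have : `|s| <= M ^+ 2 by apply: (mean_norm_le mE) => //; cont.
by rewrite /K; have := M0; lra.
Qed.

Let le_u h1 h2 b : `|b| <= M -> `|u h1 h2 b| <= K * (`|h1| + `|h2|).
Proof.
move=> bM; rewrite (le_trans (ler_normD _ _))// !normrM mulrDr ![K * _]mulrC.
by rewrite lerD// ler_wpM2l// (le_center1, le_center2).
Qed.

Let cts_u h1 h2 : cts (u h1 h2).
Proof. by rewrite /u; cont. Qed.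

Let sqr_le_norm (x y : R) : `|x| <= y -> x ^+ 2 <= y ^+ 2.
Proof.
move=> xy; rewrite -real_normK ?num_real// ler_sqr ?nnegrE//.
exact: le_trans xy.
Qed.

Lemma covq_le h1 h2 : covq E h1 h2 <= (K * (`|h1| + `|h2|)) ^+ 2.
Proof.
rewrite -(mean_u2 mE) -[leRHS](mean_cst mE); apply: (le_mean mE); [cont..|].
by move=> b bM; exact/sqr_le_norm/(le_u h1 h2 bM).
Qed.

Lemma covq_ge0 h1 h2 : 0 <= covq E h1 h2.
Proof.
by rewrite -(mean_u2 mE); apply: (mean_ge0 mE); [cont|move=> b _; exact: sqr_ge0].
Qed.

(** Extracting the mean of the exponent leaves the centered [u], so first-order terms vanish
    below. *)
Lemma quadexp_center h1 h2 b :
  quadexp h1 h2 b = expR (h1 * m + h2 * s) * expR (u h1 h2 b).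
Proof. by rewrite -expRD /quadexp /u; congr expR; ring. Qed.

Lemma ln_mean_quadexp_center h1 h2 :
  ln (E (quadexp h1 h2)) = h1 * m + h2 * s + ln (E (fun b => expR (u h1 h2 b))).
Proof.
rewrite (_ : quadexp _ _ = fun b => expR (h1 * m + h2 * s) * expR (u h1 h2 b)).
  rewrite (meanZ mE); last by rewrite /u; cont.
  rewrite lnM ?posrE ?expR_gt0 ?expRK//.
  by apply: lt_le_trans (mean_jensen mE _); rewrite ?expR_gt0.
by apply/funext => b; exact: quadexp_center.
Qed.

(** Convexity: the tangent plane at the origin lies below the log-partition function. It is Jensen's
    inequality for the centered [u]. *)
Lemma ln_mean_quadexp_ge h1 h2 : h1 * m + h2 * s <= ln (E (quadexp h1 h2)).
Proof.
rewrite ln_mean_quadexp_center lerDl ln_ge0//.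
have := mean_jensen mE (@cts_u h1 h2).
by rewrite (mean_u mE) expR0.
Qed.

Section small.
Variables h1 h2 : R.
Hypothesis small : K * (`|h1| + `|h2|) <= 1 / 4.

Let nh0 : 0 <= K * (`|h1| + `|h2|).
Proof. by apply: mulr_ge0; [have := K1; lra|apply: addr_ge0]. Qed.

Let small_u b : `|b| <= M -> `|u h1 h2 b| <= 1 / 4.
Proof. by move=> bM; exact: le_trans (le_u h1 h2 bM) small. Qed.

Let mean_exp_le : E (fun b => expR (u h1 h2 b)) <= 1 + covq E h1 h2.
Proof.
have -> : 1 + covq E h1 h2 = E (fun b => 1 + u h1 h2 b + u h1 h2 b ^+ 2).
  rewrite /u (meanD mE); try by cont.
  rewrite (meanD mE); try by cont.
  by rewrite (mean1 mE) (mean_u mE) (mean_u2 mE) addr0.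
apply: (le_mean mE); [by rewrite /u; cont..|].
by move=> b /small_u; exact: expR_le_quad.
Qed.

Let mean_exp_ge : 1 + covq E h1 h2 / 4 <= E (fun b => expR (u h1 h2 b)).
Proof.
have -> : 1 + covq E h1 h2 / 4 = E (fun b => 1 + u h1 h2 b + 4^-1 * u h1 h2 b ^+ 2).
  rewrite /u (meanD mE); try by cont.
  rewrite (meanD mE); try by cont.
  rewrite (meanZ mE); try by cont.
  by rewrite (mean1 mE) (mean_u mE) (mean_u2 mE) addr0 mulrC.
apply: (le_mean mE); [by rewrite /u; cont..|].
move=> b /small_u; rewrite ler_norml => /andP[bu _].
by rewrite [4^-1 * _]mulrC; apply: expR_ge_quad; lra.
Qed.

Lemma ln_mean_quadexp_le :
  ln (E (quadexp h1 h2)) <= h1 * m + h2 * s + (K * (`|h1| + `|h2|)) ^+ 2.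
Proof.
rewrite ln_mean_quadexp_center lerD2l; apply: le_trans (covq_le h1 h2).
have := covq_ge0 h1 h2; have := mean_exp_le; have := mean_exp_ge.
set z := E _; set q := covq _ _ _ => z1 z2 q0.
have -> : z = 1 + (z - 1) by ring.
have z10 : - 1 < z - 1 by lra.
by apply: (le_trans (le_ln1Dx z10)); lra.
Qed.

(** Local strong convexity, from [E e^u >= 1 + q/4] and [ln (1 + z) >= z/2], where [q] is the
    variance of [u]. *)
Lemma ln_mean_quadexp_ge_quad :
  h1 * m + h2 * s + covq E h1 h2 / 8 <= ln (E (quadexp h1 h2)).
Proof.
rewrite ln_mean_quadexp_center lerD2l.
have := covq_ge0 h1 h2; have := covq_le h1 h2; have := mean_exp_ge.
set z := E _; set q := covq _ _ _ => z1 q1 q0.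
have q2 : q <= 1 / 2.
  apply: (le_trans q1); move: small nh0; set k := K * _ => k1 k0; nra.
have : 0 <= q / 4 <= 1 / 2 by lra.
move/ln1D_ge_half => h; apply: (@le_trans _ _ (ln (1 + q / 4))); first lra.
by rewrite ler_ln ?posrE//; lra.
Qed.

(** With [a = E (f u)] and [D = E e^u], the numerator is [a + r] with [r] quadratic, and [D - 1] is
    quadratic. The error is [(r + a (1 - D)) / D], and [a (1 - D)] is cubic. *)
Let ratio_estimate f : cts f -> (forall b, `|b| <= M -> `|f b| <= K) -> E f = 0 ->
  `|E (fun b => f b * expR (u h1 h2 b)) / E (fun b => expR (u h1 h2 b))
    - E (fun b => f b * u h1 h2 b)| <= 2 * K ^+ 3 * (`|h1| + `|h2|) ^+ 2.
Proof.
move=> cf fK f0.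
have -> : 2 * K ^+ 3 * (`|h1| + `|h2|) ^+ 2 = 2 * K * (K * (`|h1| + `|h2|)) ^+ 2.
  by ring.
have := mean_exp_le; have := mean_exp_ge; have := covq_le h1 h2.
have := covq_ge0 h1 h2.
set D := E (fun b => expR (u h1 h2 b)); set k := K * (`|h1| + `|h2|).
set q := covq _ _ _ => q0 qk D1 D2.
have k0 : 0 <= k := nh0; have k1 : k <= 1 / 4 := small.
set a := E (fun b => f b * u h1 h2 b).
have ak : `|a| <= K * k.
  apply: (mean_norm_le mE); first by rewrite /u; cont.
  by move=> b bM; rewrite normrM; apply: ler_pM => //; [exact: fK|exact: le_u].
pose r := E (fun b => f b * (expR (u h1 h2 b) - 1 - u h1 h2 b)).
have rk : `|r| <= K * k ^+ 2.
  apply: (mean_norm_le mE); first by rewrite /u; cont.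
  move=> b bM; rewrite normrM; apply: ler_pM => //; first exact: fK.
  have ub := small_u bM; have ub' := le_u h1 h2 bM.
  have u1 := expR_le_quad ub.
  have u2 : 1 + u h1 h2 b <= expR (u h1 h2 b) by exact: expR_ge1Dx.
  rewrite ger0_norm; last by lra.
  by apply: le_trans (sqr_le_norm ub'); lra.
have -> : E (fun b => f b * expR (u h1 h2 b)) = r + a.
  rewrite -(meanD mE); try by rewrite /u; cont.
  transitivity (E (fun b => f b * expR (u h1 h2 b)) - E f); first by rewrite f0 subr0.
  rewrite -(meanB mE) //; try by rewrite /u; cont.
  by congr (E _); apply/funext => b; ring.
have D10 : 1 <= D by lra.
have Dn0 : D != 0 by rewrite gt_eqF// (lt_le_trans ltr01).
have -> : (r + a) / D - a = (r + a * (1 - D)) / D.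
  by rewrite mulrBr mulr1 addrA mulrBl mulfK.
have D0 : 0 < D by exact: lt_le_trans ltr01 D10.
rewrite normrM normfV (ger0_norm (ltW D0)) ler_pdivrMr//.
have ra : `|r + a * (1 - D)| <= K * k ^+ 2 + K * k * k ^+ 2.
  apply: (le_trans (ler_normD _ _)); apply: lerD => //.
  rewrite normrM; apply: ler_pM => //.
  by rewrite distrC ger0_norm; lra.
apply: (le_trans ra).
have K0 : 0 <= K by exact: le_trans ler01 K1.
have Kk : 0 <= K * k ^+ 2 by rewrite mulr_ge0 ?sqr_ge0.
(* The cubic term is absorbed using [k <= 1/4]. *)
apply: (@le_trans _ _ (2 * K * k ^+ 2)); first by nra.
by rewrite ler_peMr//; lra.
Qed.

(** The constant [e^(h1 m + h2 s)] cancels between numerator and denominator. *)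
Let tilted_center f : cts f ->
  tilted E h1 h2 f - E f =
  E (fun b => (f b - E f) * expR (u h1 h2 b)) / E (fun b => expR (u h1 h2 b)).
Proof.
move=> cf.
have -> : tilted E h1 h2 f - E f = tilted E h1 h2 (fun b => f b - E f).
  rewrite (meanB (mean_tilted mE h1 h2)) ?(mean_cst (mean_tilted mE h1 h2))//.
  by cont.
rewrite /tilted.
have -> : quadexp h1 h2 = fun b => expR (h1 * m + h2 * s) * expR (u h1 h2 b).
  by apply/funext => b; rewrite quadexp_center.
rewrite (meanZ mE); last by rewrite /u; cont.
rewrite invfM mulrA; congr (_ / _).
set k := expR (h1 * m + h2 * s).
transitivity (E (fun b => k * ((f b - E f) * expR (u h1 h2 b))) / k).
  by congr (E _ / _); apply/funext => b; ring.
rewrite (meanZ mE); last by rewrite /u; cont.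
have k0 : k != 0 by rewrite gt_eqF ?expR_gt0.
by rewrite mulrC mulKf.
Qed.

(** This and [tilted_sqr_estimate] say that the mean map has the covariance matrix as derivative at
    the origin, with quadratic error. *)
Lemma tilted_id_estimate :
  `|tilted E h1 h2 (fun b => b) - m - (h1 * cov11 E + h2 * cov12 E)|
  <= 2 * K ^+ 3 * (`|h1| + `|h2|) ^+ 2.
Proof.
rewrite tilted_center; last by cont.
have e : E (fun b => (b - m) * u h1 h2 b) = h1 * cov11 E + h2 * cov12 E.
  rewrite (meanM_u mE); last by cont.
  by rewrite /cov11 /cov12; congr (h1 * E _ + _); apply/funext => b; rewrite expr2.
rewrite -e; apply: ratio_estimate => //; first by cont.
by rewrite (meanB mE) ?(mean_cst mE) ?subrr//; cont.
Qed.

Lemma tilted_sqr_estimate :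
  `|tilted E h1 h2 (fun b => b ^+ 2) - s - (h1 * cov12 E + h2 * cov22 E)|
  <= 2 * K ^+ 3 * (`|h1| + `|h2|) ^+ 2.
Proof.
rewrite tilted_center; last by cont.
have e : E (fun b => (b ^+ 2 - s) * u h1 h2 b) = h1 * cov12 E + h2 * cov22 E.
  rewrite (meanM_u mE); last by cont.
  rewrite /cov22 /cov12; rewrite -/m -/s; congr (h1 * E _ + h2 * E _); apply/funext => b.
  by rewrite mulrC.
rewrite -e; apply: ratio_estimate => //; first by cont.
by rewrite (meanB mE) ?(mean_cst mE) ?subrr//; cont.
Qed.

End small.

End local_estimates.

(** * The gradient of the log-partition function and its local inverse *)

Section lipschitz_plane.
Context {R : realType}.

Lemma continuous_lipschitz_plane (F : R * R -> R) (C : R) : 0 < C ->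
  (forall p q, `|F p - F q| <= C * (`|p.1 - q.1| + `|p.2 - q.2|)) ->
  continuous F.
Proof.
move=> C0 FC p; apply/cvgrPdist_lt => e e0; near=> q.
apply: (le_lt_trans (FC p q)).
have : `|p - q| < e / (2 * C).
  near: q; apply: cvgr_dist_lt => //; first by rewrite divr_gt0// mulr_gt0.
rewrite prod_normE/= gt_max ltr_pdivlMr ?mulr_gt0// ltr_pdivlMr ?mulr_gt0//.
by move=> /andP[]; lra.
Unshelve. all: by end_near. Qed.

(** First-order optimality: dividing by a small [k] with the sign of [d] leaves [|d| <= |B| |k|]. *)
Lemma eq0_of_quadratic_bound (d B r : R) : 0 < r ->
  (forall k, `|k| < r -> k * d <= B * k ^+ 2) -> d = 0.
Proof.
move=> r0 H; apply/eqP; rewrite -normr_eq0; apply/eqP.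
apply/eqP; rewrite eq_le normr_ge0 andbT; apply/ler_addgt0Pr => e e0.
rewrite add0r.
(* [t] stays inside the radius and makes [|B| t] at most [e]. *)
pose t := Num.min (r / 2) (e / (`|B| + 1)).
have B1 : 0 < `|B| + 1 by rewrite ltr_wpDl.
have t0 : 0 < t by rewrite lt_min !divr_gt0.
have tr : t < r by rewrite gt_min; apply/orP; left; lra.
have te : t * (`|B| + 1) <= e by rewrite -ler_pdivlMr// ge_min lexx orbT.
have : t * `|d| <= `|B| * t ^+ 2.
  have Bt : B * t ^+ 2 <= `|B| * t ^+ 2 by rewrite ler_wpM2r ?sqr_ge0 ?ler_norm.
  apply: le_trans Bt; have [d0|d0] := leP 0 d.
    by rewrite (ger0_norm d0); apply: H; rewrite gtr0_norm.
  by rewrite (ltr0_norm d0) -(sqrrN t) mulrN -mulNr; apply: H; rewrite normrN gtr0_norm.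
rewrite expr2 mulrCA ler_pM2l// => dB; apply: (le_trans dB).
by apply: le_trans te; rewrite mulrC ler_pM2l//; lra.
Qed.

End lipschitz_plane.

(** * Local inversion of the mean map *)

Section local_inverse.
Context {R : realType} (M : R) (S : set R).
Implicit Types (E : (R -> R) -> R) (a c m s : R).

Hypothesis three_points : exists a b c, S a /\ S b /\ S c /\
  a <> b /\ a <> c /\ b <> c.

Let K : R := 1 + 2 * M + 2 * M ^+ 2.

(** The tangent inequality at [(a, c)], whose slopes are tilted means of [b] and [b^2] and hence
    bounded by [K]. *)
Lemma ln_mean_quadexp_lipschitz E : mean M S E -> forall a c a' c',
  ln (E (quadexp a c)) - ln (E (quadexp a' c')) <= K * (`|a - a'| + `|c - c'|).
Proof.
move=> mE a c a' c'; have mT := mean_tilted mE a c.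
have := ln_mean_quadexp_ge mT (a' - a) (c' - c).
rewrite (ln_tilted_quadexp mE) !subrKC.
have M0 := mean_Mge0 mE.
have KM : `|tilted E a c (fun b => b)| <= K.
  apply: (le_trans (mean_norm_m mT)); rewrite /K; have := sqr_ge0 M; lra.
have KM2 : `|tilted E a c (fun b => b ^+ 2)| <= K.
  apply: (@le_trans _ _ (M ^+ 2)); last by rewrite /K; have := sqr_ge0 M; lra.
  apply: (mean_norm_le mT); first by cont.
  by move=> b bM; rewrite normrX ler_sqr ?nnegrE.
set x := tilted _ _ _ _ in KM *; set y := tilted _ _ _ _ in KM2 *.
have n1 : (a - a') * x <= `|a - a'| * K.
  by apply: (le_trans (ler_norm _)); rewrite normrM ler_wpM2l.
have n2 : (c - c') * y <= `|c - c'| * K.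
  by apply: (le_trans (ler_norm _)); rewrite normrM ler_wpM2l.
by lra.
Qed.

Lemma continuous_ln_mean_quadexp E : mean M S E -> forall m s,
  continuous (fun h : R * R => ln (E (quadexp h.1 h.2)) - h.1 * m - h.2 * s).
Proof.
move=> mE m s; have M0 := mean_Mge0 mE.
have K1 : 1 <= K by rewrite /K; have := sqr_ge0 M; lra.
have C0 : 0 < K + `|m| + `|s| by have := normr_ge0 m; have := normr_ge0 s; lra.
apply: (continuous_lipschitz_plane C0) => p q.
have l1 := ln_mean_quadexp_lipschitz mE p.1 p.2 q.1 q.2.
have l2 := ln_mean_quadexp_lipschitz mE q.1 q.2 p.1 p.2.
rewrite (distrC q.1) (distrC q.2) in l2.
have n1 : `|(p.1 - q.1) * m| <= `|p.1 - q.1| * `|m| by rewrite normrM.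
have n2 : `|(p.2 - q.2) * s| <= `|p.2 - q.2| * `|s| by rewrite normrM.
have e1 : 0 <= `|p.1 - q.1| * `|s| by rewrite mulr_ge0.
have e2 : 0 <= `|p.2 - q.2| * `|m| by rewrite mulr_ge0.
move: n1 n2; rewrite !ler_norml => /andP[? ?] /andP[? ?].
by apply/andP; split; lra.
Qed.

Lemma mean_quadexp00 E : mean M S E -> E (quadexp 0 0) = 1.
Proof.
move=> mE; rewrite -(mean1 mE); congr (E _); apply/funext => b.
by rewrite /quadexp !mul0r addr0 expR0.
Qed.

(* The preimage of (m, s) is the minimizer of the convex function
   [ln (E e^(h.t)) - h.(m, s)] on a small square: its coercivity keeps the
   minimizer away from the boundary. *)
Lemma tilted_local_surjection E : mean M S E ->
  exists r C : R, [/\ 0 < r, 0 < C & forall m s,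
    `|m - E (fun b => b)| < r -> `|s - E (fun b => b ^+ 2)| < r ->
    exists h1 h2, [/\ tilted E h1 h2 (fun b => b) = m,
      tilted E h1 h2 (fun b => b ^+ 2) = s,
      K * (`|h1| + `|h2|) <= 1 / 4 &
      `|h1| + `|h2| <= C * (`|m - E (fun b => b)| + `|s - E (fun b => b ^+ 2)|)]].
Proof.
move=> mE; have M0 := mean_Mge0 mE.
have K1 : 1 <= K by rewrite /K; have := sqr_ge0 M; lra.
have K0 : 0 < K by lra.
pose al := covdet E / (cov11 E + cov22 E).
have al0 : 0 < al.
  rewrite divr_gt0 ?(covdet_gt0 mE)//.
  by rewrite addr_gt0 ?(cov11_gt0 mE) ?(cov22_gt0 mE).
(* [C] is what [al * hn^2 <= 16 * hn * dl] yields below; [r] is chosen so that the quadratic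
   estimates hold on the whole square of half-side [r]. *)
pose C := 16 / al; have C0 : 0 < C by rewrite divr_gt0.
pose r := (8 * K)^-1; have r0 : 0 < r by rewrite invr_gt0 mulr_gt0.
have rK : r * K = 1 / 8 by rewrite /r; field; rewrite gt_eqF.
have rC0 : 0 < r / (4 * C) by rewrite divr_gt0// mulr_gt0.
(* With this radius [C * dl < r], so the minimizer is interior to the square. *)
exists (r / (4 * C)), C; split => // m s.
set m0 := E (fun b => b); set s0 := E (fun b => b ^+ 2) => mr sr.
pose F (h : R * R) := ln (E (quadexp h.1 h.2)) - h.1 * m - h.2 * s.
have cA : compact (`[- r, r]%classic `*` `[- r, r]%classic : set (R * R)).
  by apply: compact_setX; exact: segment_compact.
have [||[h1 h2]] := @compact_EVT_min _ R F _ _ cA.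
- by exists (0, 0); split; rewrite /= in_itv/= oppr_le0 (ltW r0).
- by apply: continuous_subspaceT; exact: continuous_ln_mean_quadexp.
rewrite inE => -[] /=; rewrite !in_itv/= => h1r h2r minF.
have {}minF k1 k2 : `|k1| <= r -> `|k2| <= r -> F (h1, h2) <= F (k1, k2).
  by rewrite !ler_norml => k1r k2r; apply: minF; rewrite inE; split; rewrite /= in_itv.
have nh1 : `|h1| <= r by rewrite ler_norml.
have nh2 : `|h2| <= r by rewrite ler_norml.
have small : K * (`|h1| + `|h2|) <= 1 / 4.
  have : K * (`|h1| + `|h2|) <= K * (r + r) by rewrite ler_wpM2l ?(ltW K0)// lerD.
  by rewrite [K * (r + r)]mulrDr [K * r]mulrC rK; lra.
set hn := `|h1| + `|h2|; set dl := `|m - m0| + `|s - s0|.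
have hn0 : 0 <= hn by rewrite addr_ge0.
have dl0 : 0 <= dl by rewrite addr_ge0.
(* The minimum is at most the value 0 at the origin, while strong convexity bounds it below by a
   quadratic minus [hn * dl]. *)
have hdl : hn <= C * dl.
  have F0 : F (h1, h2) <= 0.
    have <- : F (0, 0) = 0 by rewrite /F/= mean_quadexp00// ln1 !mul0r !subr0.
    by apply: minF; rewrite normr0 ltW.
  have := ln_mean_quadexp_ge_quad mE small; rewrite -/m0 -/s0 => low.
  have coer := covq_coercive mE three_points h1 h2; rewrite -/al in coer.
  have n1 : h1 * (m - m0) <= `|h1| * `|m - m0|.
    by apply: (le_trans (ler_norm _)); rewrite normrM.
  have n2 : h2 * (s - s0) <= `|h2| * `|s - s0|.
    by apply: (le_trans (ler_norm _)); rewrite normrM.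
  have n3 : `|h1| * `|m - m0| + `|h2| * `|s - s0| <= hn * dl.
    rewrite /hn /dl mulrDl; apply: lerD; apply: ler_wpM2l => //.
      by rewrite lerDl.
    by rewrite lerDr.
  have n4 : al * (h1 ^+ 2 + h2 ^+ 2) <= 8 * (hn * dl).
    move: F0 low n1 n2 n3; rewrite /F/=; lra.
  have n5 : hn ^+ 2 <= 2 * (h1 ^+ 2 + h2 ^+ 2).
    rewrite -(real_normK (num_real h1)) -(real_normK (num_real h2)) /hn.
    by have := sqr_ge0 (`|h1| - `|h2|); lra.
  have n6 : al * hn ^+ 2 <= 16 * (hn * dl).
    apply: (@le_trans _ _ (al * (2 * (h1 ^+ 2 + h2 ^+ 2)))).
      by rewrite ler_pM2l.
    by lra.
  have [->|hnn0] := eqVneq hn 0; first by rewrite mulr_ge0 ?(ltW C0).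
  have hnp : 0 < hn by rewrite lt_neqAle eq_sym hnn0.
  rewrite /C mulrAC ler_pdivlMr// -(ler_pM2l hnp).
  by move: n6; rewrite expr2; lra.
have hnr : hn < r.
  apply: (le_lt_trans hdl); rewrite -ltr_pdivlMl//.
  have -> : C^-1 * r = 4 * (r / (4 * C)).
    by field; rewrite gt_eqF.
  by rewrite /dl; lra.
have mT := mean_tilted mE h1 h2.
(* Increments below [eta] stay in the square and satisfy the smallness condition of the quadratic
   upper bound. *)
pose eta := Num.min (r - hn) (1 / (4 * K)).
have eta0 : 0 < eta by rewrite lt_min subr_gt0 hnr divr_gt0// mulr_gt0.
(* Minimality at [(h1, h2)] combined with the quadratic upper bound for the mean tilted there. *)
have key k1 k2 : `|k1| + `|k2| < eta ->
    k1 * m + k2 * s <= k1 * tilted E h1 h2 (fun b => b)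
      + k2 * tilted E h1 h2 (fun b => b ^+ 2) + (K * (`|k1| + `|k2|)) ^+ 2.
  rewrite lt_min => /andP[k1r kK].
  have ks : K * (`|k1| + `|k2|) <= 1 / 4.
    rewrite mulrC -ler_pdivlMr//; apply/ltW/(lt_le_trans kK).
    by rewrite le_eqVlt; apply/orP; left; apply/eqP; field; rewrite gt_eqF.
  have := ln_mean_quadexp_le mT ks; rewrite (ln_tilted_quadexp mE) -/K.
  have : F (h1, h2) <= F (h1 + k1, h2 + k2).
    have := ler_normD h1 k1; have := ler_normD h2 k2.
    have := normr_ge0 k1; have := normr_ge0 k2.
    have := normr_ge0 h1; have := normr_ge0 h2; move: k1r; rewrite /hn => *.
    by apply: minF; lra.
  by rewrite /F/=; lra.
(* Taking [key] along each axis gives the two stationarity equations. *)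
exists h1, h2; split => //.
- apply/eqP; rewrite eq_sym -subr_eq0; apply/eqP.
  apply: (eq0_of_quadratic_bound (B := K ^+ 2) eta0) => k ke.
  have := key k 0; rewrite normr0 addr0 => /(_ ke).
  by rewrite !mul0r !addr0 exprMn real_normK ?num_real//; lra.
- apply/eqP; rewrite eq_sym -subr_eq0; apply/eqP.
  apply: (eq0_of_quadratic_bound (B := K ^+ 2) eta0) => k ke.
  have := key 0 k; rewrite normr0 add0r => /(_ ke).
  by rewrite !mul0r !add0r exprMn real_normK ?num_real//; lra.
Qed.

(** The forward expansion at the preimage is solved by Cramer's rule: its errors are multiplied by
    the adjugate of the covariance matrix and divided by the determinant. *)
Lemma tilted_local_inverse E : mean M S E -> forall a c,
  let T := tilted E a c in
  exists r C : R, [/\ 0 < r, 0 <= C & forall m s,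
    let dm := m - T (fun b => b) in let ds := s - T (fun b => b ^+ 2) in
    `|dm| < r -> `|ds| < r ->
    exists a' c', [/\ tilted E a' c' (fun b => b) = m,
      tilted E a' c' (fun b => b ^+ 2) = s,
      `|a' - a| + `|c' - c| <= C * (`|dm| + `|ds|),
      `|a' - a - (cov22 T * dm - cov12 T * ds) / covdet T|
        <= C * (`|dm| + `|ds|) ^+ 2 &
      `|c' - c - (cov11 T * ds - cov12 T * dm) / covdet T|
        <= C * (`|dm| + `|ds|) ^+ 2]].
Proof.
move=> mE a c T; have mT : mean M S T := mean_tilted mE a c.
have M0 := mean_Mge0 mE.
have [r [C [r0 C0 loc]]] := tilted_local_surjection mT.
have K0 : 0 < K by rewrite /K; have := sqr_ge0 M; lra.
pose B := 2 * K ^+ 3; have B0 : 0 < B by rewrite mulr_gt0// exprn_gt0.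
pose A := cov11 T + `|cov12 T| + cov22 T.
have d0 := covdet_gt0 mT three_points.
have c11 := cov11_gt0 mT three_points; have c22 := cov22_gt0 mT three_points.
have c12 := normr_ge0 (cov12 T).
have A0 : 0 < A by rewrite /A; lra.
(* [A] bounds the rows of the adjugate, [B] is the forward error constant, and [C^2] converts
   parameter increments into mean increments. *)
pose C' := A * B / covdet T * C ^+ 2.
have C'0 : 0 <= C' by rewrite mulr_ge0 ?sqr_ge0// divr_ge0 ?mulr_ge0// ltW.
exists r, (C + C'); split => //; first by rewrite addr_ge0// ltW.
move=> m s dm ds /loc{}loc /loc[h1 [h2 [e1 e2 small hn]]].
have est1 := tilted_id_estimate mT small; have est2 := tilted_sqr_estimate mT small.
rewrite e1 -/dm -/K -/B in est1; rewrite e2 -/ds -/K -/B in est2.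
rewrite -/dm -/ds in hn.
exists (a + h1), (c + h2); rewrite -!(tilted_tilted mE) -/T e1 e2.
rewrite [a + h1]addrC [c + h2]addrC !addrK.
set dl := `|dm| + `|ds| in hn *; have dl0 : 0 <= dl by rewrite addr_ge0.
set r1 := (X in `|X| <= _) in est1; set r2 := (X in `|X| <= _) in est2.
have hn2 : B * (`|h1| + `|h2|) ^+ 2 <= B * C ^+ 2 * dl ^+ 2.
  rewrite -mulrA ler_pM2l// -exprMn lerXn2r// nnegrE ?addr_ge0//.
  by rewrite mulr_ge0// ltW.
have fin q1 q2 : `|q1| <= A -> `|q2| <= A -> `|q1| + `|q2| <= A ->
    `|(q1 * r1 + q2 * r2) / covdet T| <= (C + C') * dl ^+ 2.
  move=> q1A q2A qA.
  apply: (@le_trans _ _ (C' * dl ^+ 2)); last first.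
    by rewrite ler_wpM2r ?sqr_ge0// lerDr ltW.
  rewrite normrM normfV (gtr0_norm d0) ler_pdivrMr//.
  have -> : C' * dl ^+ 2 * covdet T = A * (B * C ^+ 2 * dl ^+ 2).
    by rewrite /C'; field; rewrite gt_eqF.
  apply: (le_trans (ler_normD _ _)); rewrite !normrM.
  apply: (@le_trans _ _ ((`|q1| + `|q2|) * (B * C ^+ 2 * dl ^+ 2))).
    by rewrite mulrDl; apply: lerD; apply: ler_wpM2l => //; apply: le_trans hn2.
  by rewrite ler_wpM2r// -mulrA mulr_ge0 ?(ltW B0)// mulr_ge0 ?sqr_ge0.
split => //.
- by apply: (le_trans hn); rewrite ler_wpM2r// lerDl.
- have -> : h1 - (cov22 T * dm - cov12 T * ds) / covdet T =
      (- cov22 T * r1 + cov12 T * r2) / covdet T.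
    by rewrite /r1 /r2 /covdet; field; rewrite -/(covdet T) gt_eqF.
  by apply: fin; rewrite ?normrN ?(gtr0_norm c22) /A; lra.
- have -> : h2 - (cov11 T * ds - cov12 T * dm) / covdet T =
      (cov12 T * r1 + - cov11 T * r2) / covdet T.
    by rewrite /r1 /r2 /covdet; field; rewrite -/(covdet T) gt_eqF.
  by apply: fin; rewrite ?normrN ?(gtr0_norm c11) /A; lra.
Qed.

(* Both inequalities are the convexity of [phi], at either of the two points. *)
Lemma conjugate_squeeze E : mean M S E -> forall a c a' c',
  let phi a c := ln (E (quadexp a c)) in
  let m := tilted E a c (fun b => b) in let s := tilted E a c (fun b => b ^+ 2) in
  let m' := tilted E a' c' (fun b => b) in
  let s' := tilted E a' c' (fun b => b ^+ 2) in
  0 <= (a' * m' + c' * s' - phi a' c') - (a * m + c * s - phi a c)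
       - (a * (m' - m) + c * (s' - s))
    <= (a' - a) * (m' - m) + (c' - c) * (s' - s).
Proof.
move=> mE a c a' c'; cbv zeta.
have := ln_mean_quadexp_ge (mean_tilted mE a c) (a' - a) (c' - c).
have := ln_mean_quadexp_ge (mean_tilted mE a' c') (a - a') (c - c').
rewrite !(ln_tilted_quadexp mE) !subrKC.
by move=> h1 h2; apply/andP; split; lra.
Qed.

End local_inverse.

(** * The prior and its exponential family *)

Lemma mnormalize_fin d (T : measurableType d) (R : realType)
    (mu : {measure set T -> \bar R}) (P : probability T R) (z : R) (A : set T) :
  mu setT = z%:E -> 0 < z -> mnormalize mu P A = (mu A * z^-1%:E)%E.
Proof. by move=> muT z0; rewrite /mnormalize muT eqe gt_eqF. Qed.

Section support.
Context {R : realType}.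
Variable P0 : probability (measurableTypeR R) R.

(* The complement of the support is covered by the countably many null
   intervals with rational endpoints. *)
Lemma msupport_setC_negligible : P0.-negligible (~` msupport P0).
Proof.
pose J (pq : rat * rat) : set R := `]ratr pq.1, ratr pq.2[%classic.
(* Indices coding no pair and intervals of nonzero mass contribute the empty set. *)
pose F n : set (measurableTypeR R) :=
  if unpickle n is Some pq then (if P0 (J pq) == 0%E then J pq else set0) else set0.
apply: (@negligibleS _ _ _ _ (\bigcup_n F n)); last first.
  apply: negligible_bigcup => n; rewrite /F; case: unpickle => [pq|]; last first.
    exact: negligible_set0.
  case: ifPn => [/eqP J0|_]; last exact: negligible_set0.
  by apply/negligibleP => //; exact: measurable_itv.
move=> x /=; rewrite /msupport/= => /existsNP[U /not_implyP[oU /not_implyP[Ux PU]]].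
have [e /= e0 eU] := open_nbhs_nbhs (conj oU Ux).
have [p /andP[p1 p2]] : exists p : rat, x - e < ratr p < x.
  have [||y [/= + [p _ py]]] := @dense_rat R `]x - e, x[%classic.
  - by exists (x - e / 2); rewrite /= in_itv/=; apply/andP; split; lra.
  - exact: interval_open.
  by rewrite in_itv/= -py => h; exists p.
have [q /andP[q1 q2]] : exists q : rat, x < ratr q < x + e.
  have [||y [/= + [q _ qy]]] := @dense_rat R `]x, x + e[%classic.
  - by exists (x + e / 2); rewrite /= in_itv/=; apply/andP; split; lra.
  - exact: interval_open.
  by rewrite in_itv/= -qy => h; exists q.
have [N NK] : exists N, unpickle N = Some (p, q).
  by exists (pickle (p, q)); rewrite pickleK.
exists N; first exact: I; rewrite /F NK.
have JU : J (p, q) `<=` U.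
  move=> y; rewrite /J/= in_itv/= => /andP[y1 y2]; apply: eU => /=.
  by rewrite /ball_/= ltr_distlC; apply/andP; split; lra.
have -> : P0 (J (p, q)) = 0%E.
  apply/eqP; rewrite eq_le measure_ge0 andbT.
  have /negP := PU; rewrite -leNgt; apply: le_trans.
  apply: le_measure => //; rewrite inE; first exact: measurable_itv.
  exact: open_measurable.
by rewrite eqxx /J /= in_itv/= p2 q1.
Qed.

End support.

(** * The prior as a mean functional *)

Section prior_mean.
Context {R : realType} (M : R).
Variable P0 : probability (measurableTypeR R) R.
Hypothesis supp_M : msupport P0 `<=` [set b | - M <= b <= M].

Let D : set (measurableTypeR R) := `[- M, M]%classic.

Let mD : measurable D. Proof. exact: measurable_itv. Qed.

Let DP b : D b <-> `|b| <= M.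
Proof. by rewrite /D /= in_itv/= ler_norml. Qed.

Let setCD0 : P0 (~` D) = 0%E.
Proof.
apply: measure_negligible; first exact: measurableC.
apply: negligibleS (msupport_setC_negligible P0).
by apply: subsetC => b /supp_M /=; rewrite /D /= in_itv.
Qed.

Lemma cts_measurable (f : R -> R) : cts f ->
  measurable_fun [set: measurableTypeR R] f.
Proof. by move=> cf; apply: continuous_measurable_fun. Qed.

Let cts_bounded (f : R -> R) : cts f -> [bounded f x | x in D].
Proof.
move=> cf; have cfD : {within D, continuous (f : R -> R)}.
  by apply: continuous_subspaceT.
have /compact_bounded[B [_ Bt]] := continuous_compact cfD (@segment_compact R (- M) M).
by exists B; split; rewrite ?num_real// => ? ? ? ?; exact: Bt.
Qed.

Let cts_integrable (mu : {finite_measure set (measurableTypeR R) -> \bar R})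
  (f : R -> R) : cts f -> mu.-integrable D (EFin \o f).
Proof.
move=> cf; apply: measurable_bounded_integrable => //.
- by rewrite -ge0_fin_numE// fin_num_measure.
- by apply: measurable_funTS; exact: cts_measurable.
- exact: cts_bounded.
Qed.

(** Integration is restricted to [[- M, M]], where every continuous function is bounded and hence
    integrable. *)
Definition prior_mean (f : R -> R) : R := \int[P0]_(b in D) f b.

Let integral_conc (mu : {measure set (measurableTypeR R) -> \bar R}) (f : R -> R) :
  mu (~` D) = 0%E -> cts f ->
  (\int[mu]_b (f b)%:E = \int[mu]_(b in D) (f b)%:E)%E.
Proof.
move=> mu0 cf; rewrite [RHS]integral_mkcond.
have mf : measurable_fun [set: measurableTypeR R] (EFin \o f).
  by apply/measurable_EFinP; exact: cts_measurable.
apply: ae_eq_integral => //.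
  by apply/(measurable_restrictT _ mD); apply: measurable_funTS.
exists (~` D); split => //; first exact: measurableC.
move=> b /= H Db; apply: H => _.
by rewrite patchE mem_set.
Qed.

Lemma mean_prior : mean M (msupport P0) prior_mean.
Proof.
split.
- by move=> f g cf cg; rewrite /prior_mean RintegralD//; exact: cts_integrable.
- by move=> k f cf; rewrite /prior_mean RintegralZl//; exact: cts_integrable.
- by move=> f cf f0; apply: Rintegral_ge0 => b /DP; exact: f0.
- move=> f a cf f0 Sa fa.
  have intf := cts_integrable P0 cf.
  rewrite /prior_mean /Rintegral fine_gt0// ltey_eq integrable_fin_num// andbT.
  (* Strict positivity: [f] exceeds [f a / 2] on an open set around [a], which has positive mass
     because [a] is in the support. *)
  pose U : set (measurableTypeR R) := [set b | f a / 2 < f b].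
  have oU : @open R U.
    have -> : U = f @^-1` [set y | f a / 2 < y] by [].
    by apply: open_comp; [move=> x _; exact: cf|exact: open_gt].
  have PU : (0 < P0 U)%E by apply: Sa => //; rewrite /U/=; lra.
  have mU : measurable U by exact: open_measurable.
  have mDU : measurable (D `&` U) by exact: measurableI.
  have PDU : P0 (D `&` U) = P0 U.
    apply/esym; rewrite -[in LHS](setIT U) -(setUv D) setIUr measureU//.
    - rewrite [U `&` D]setIC [X in (_ + X)%E](_ : _ = 0%E) ?adde0//.
      apply: (@subset_measure0 _ _ _ _ _ (~` D));
        [|exact: measurableC|exact: subIsetr|exact: setCD0].
      by apply: measurableI => //; exact: measurableC.
    - exact: measurableI.
    - by apply: measurableI => //; exact: measurableC.
    - by rewrite setIACA setICr setI0.
  apply: (@lt_le_trans _ _ (\int[P0]_(b in D `&` U) (f a / 2)%:E)%E).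
    rewrite integral_cst//; apply: mule_gt0; first by rewrite lte_fin; lra.
    by move: PU; rewrite -PDU.
  apply: (@le_trans _ _ (\int[P0]_(b in D `&` U) (f b)%:E)%E).
    apply: ge0_le_integral => //.
    + by move=> b _; rewrite lee_fin; lra.
    + apply/measurable_EFinP/measurable_funTS; exact: cts_measurable.
    + by move=> b [_ Ub]; rewrite lee_fin ltW.
  apply: ge0_subset_integral => //.
  + apply/measurable_EFinP/measurable_funTS; exact: cts_measurable.
  + by move=> b /DP /f0; rewrite lee_fin.
- rewrite /prior_mean Rintegral_cst//.
  have PD : P0 D = 1%E.
    by rewrite -(setCK D) probability_setC ?setCD0 ?sube0//; exact: measurableC.
  by rewrite mul1r; exact: (congr1 fine PD).
Qed.

Lemma integral_tiltE lambda gamma :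
  \int[P0]_b tilt lambda gamma b = prior_mean (quadexp lambda (- (gamma / 2))).
Proof.
rewrite /Rintegral integral_conc//.
  by congr fine; apply: eq_integral => b _; rewrite /tilt /quadexp addrC.
have -> : tilt lambda gamma = quadexp lambda (- (gamma / 2)).
  by apply/funext => b; rewrite /tilt /quadexp addrC.
exact: cts_quadexp.
Qed.

Section bracket.
Variables lambda gamma : R.

Let w := quadexp lambda (- (gamma / 2)).
Let Z := prior_mean w.
Let Q := expfam P0 lambda gamma.

Let Z0 : 0 < Z. Proof. exact: mean_quadexp_gt0 mean_prior _ _. Qed.

Let cts_w : cts w. Proof. exact: cts_quadexp. Qed.

Let tiltE : tilt lambda gamma = w.
Proof. by apply/funext => b; rewrite /tilt /w /quadexp addrC. Qed.

Let tilted_measureT : tilted_measure P0 lambda gamma setT = Z%:E.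
Proof.
rewrite /tilted_measure tiltE integral_conc// /Z /prior_mean /Rintegral fineK//.
by apply: integrable_fin_num => //; exact: cts_integrable.
Qed.

Let QE A : measurable A -> Q A = (\int[P0]_(b in A) (w b / Z)%:E)%E.
Proof.
move=> mA; apply: (etrans (mnormalize_fin P0 A tilted_measureT Z0)).
transitivity ((\int[P0]_(b in A) (w b)%:E) * Z^-1%:E)%E; first by rewrite -tiltE.
under [RHS]eq_integral do rewrite EFinM muleC.
rewrite ge0_integralZl_EFin ?invr_ge0 ?(ltW Z0)//.
- by rewrite muleC.
- by move=> b _; rewrite lee_fin expR_ge0.
- by apply/measurable_EFinP/measurable_funTS; exact: cts_measurable.
Qed.

Let Q_dominates : Q `<< P0.
Proof.
apply/null_content_dominatesP => A mA A0; rewrite QE//.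
apply: null_set_integral; [exact: mA| |exact: A0].
apply/measurable_EFinP; apply: measurable_funTS; apply: cts_measurable.
by apply: cts_mul => //; exact: cts_cst.
Qed.

(** The exponential family has density [w / Z] with respect to the prior, so the bracket is the
    integral of [f w / Z]. *)
Lemma bracketE (f : R -> R) : cts f ->
  bracket P0 f lambda gamma = tilted prior_mean lambda (- (gamma / 2)) f.
Proof.
move=> cf; rewrite /bracket /Rintegral -/Q integral_conc//; last first.
  exact: ((null_content_dominatesP _ _).1 Q_dominates (~` D) (measurableC mD) setCD0).
rewrite -(Radon_Nikodym_change_of_variables Q_dominates mD (cts_integrable Q cf)).
have mw : measurable_fun [set: measurableTypeR R] (fun b => (w b / Z)%:E).
  apply/measurable_EFinP; apply: cts_measurable.
  by apply: cts_mul => //; exact: cts_cst.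
have mf : measurable_fun [set: measurableTypeR R] (fun b => (f b)%:E).
  by apply/measurable_EFinP; apply: cts_measurable.
(* Uniqueness of densities: both sides integrate to [Q A] over every measurable [A] inside [D]. *)
have RN : ae_eq P0 D (Radon_Nikodym (charge_of_finite_measure Q) P0)
      (fun b => (w b / Z)%:E).
  apply: integral_ae_eq => //.
  - by apply: integrableS (Radon_Nikodym_integrable _) => //.
  - exact: measurable_funTS.
  - by move=> A AD mA; rewrite -Radon_Nikodym_integral// -QE.
transitivity (fine (\int[P0]_(b in D) ((f b)%:E * (w b / Z)%:E))%E).
  congr fine; apply: ae_eq_integral => //.
  - by apply: emeasurable_funM; apply: measurable_funTS.
  - by apply: emeasurable_funM; apply: measurable_funTS.
  - exact: ae_eqe_mul2l.
rewrite /tilted -/w -/Z /prior_mean -RintegralZr//; last first.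
  by apply: cts_integrable; exact: cts_mul.
by congr fine; apply: eq_integral => b _; rewrite -EFinM mulrA.
Qed.

End bracket.

(** By the tangent inequality at [(a, c)], the supremum is attained there, that is, at [lambda = a]
    and [gamma = - 2 c]. *)
Lemma entropyE a c :
  let m := tilted prior_mean a c (fun b => b) in
  let s := tilted prior_mean a c (fun b => b ^+ 2) in
  fine (- entropy P0 m s)%E = a * m + c * s - ln (prior_mean (quadexp a c)).
Proof.
move=> m s; rewrite /entropy oppeK.
suff -> : ereal_sup [set (- (1 / 2) * lg.2 * s + lg.1 * m
    - ln (\int[P0]_b tilt lg.1 lg.2 b)%R)%:E | lg in [set: R * R]] =
  (a * m + c * s - ln (prior_mean (quadexp a c)))%:E by [].
apply/eqP; rewrite eq_le; apply/andP; split.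
  apply: ge_ereal_sup => _ [[l g] _ <-] /=; rewrite lee_fin integral_tiltE.
  have := ln_mean_quadexp_ge (mean_tilted mean_prior a c) (l - a) (- (g / 2) - c).
  rewrite (ln_tilted_quadexp mean_prior) !subrKC -/m -/s.
  by lra.
apply: ereal_sup_ubound; exists (a, - 2 * c) => //=.
rewrite integral_tiltE.
have -> : - (- 2 * c / 2) = c by lra.
by congr EFin; lra.
Qed.

Lemma GammaP m s : Gamma P0 (m, s) <->
  exists a c, tilted prior_mean a c (fun b => b) = m /\
              tilted prior_mean a c (fun b => b ^+ 2) = s.
Proof.
have br l g : (bracket P0 id l g, bracket P0 (fun b => b ^+ 2) l g) =
    (tilted prior_mean l (- (g / 2)) (fun b => b),
     tilted prior_mean l (- (g / 2)) (fun b => b ^+ 2)).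
  by rewrite !bracketE//; cont.
split=> [[[l g] _ /= /esym]|[a [c [<- <-]]]].
  by rewrite br => -[-> ->]; exists l, (- (g / 2)).
exists (a, - 2 * c) => //=; rewrite br.
by have -> : - (- 2 * c / 2) = c by lra.
Qed.

End prior_mean.

(** * Second-order differentiability *)

Lemma is_diff0_of_quadratic (R : realType) (V W : normedModType R) (f : V -> W)
    (z : V) (C : R) :
  (\forall w \near z, `|f w - f z| <= C * `|w - z| ^+ 2) ->
  is_diff z f (0 : V -> W).
Proof.
move=> H.
have small : f \o shift z = cst (f z) + (0 : V -> W) +o_ 0 id.
  apply/eqaddoP => _ /posnumP[e]; near=> h.
  rewrite !fctE/= addr0.
  have Hh : `|f (h + z) - f z| <= C * `|h| ^+ 2.
    have : `|f (h + z) - f z| <= C * `|h + z - z| ^+ 2.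
      near: h; move: H; rewrite (near_shift 0 z); apply: filterS => w /=.
      by rewrite subr0.
    by rewrite addrK.
  apply: (le_trans Hh); rewrite expr2 mulrA ler_wpM2r//.
  apply: (@le_trans _ _ ((`|C| + 1) * `|h|)).
    by rewrite ler_wpM2r// (le_trans (ler_norm _))// lerDl.
  by rewrite mulrC -ler_pdivlMr ?ltr_wpDl.
have d0 : ('d f z : V -> W) = 0.
  by apply/diff_unique => //; move=> ?; exact: cst_continuous.
apply: DiffDef; last by rewrite d0.
apply/diff_locallyP; rewrite d0; split => //.
by move=> ?; exact: cst_continuous.
Unshelve. all: by end_near. Qed.

(** * Differentials of functions of a row vector *)

Section differentials.
Context {R : realType} {N : nat}.
Local Notation V := 'rV[R]_N.
Implicit Types (f g df dg : V -> R) (z w : V).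

Lemma is_diff_addf f g df dg z : is_diff z f df -> is_diff z g dg ->
  is_diff z (fun w => f w + g w) (fun h => df h + dg h).
Proof. by move=> ? ?; exact: is_diffD. Qed.

Lemma is_diff_mulf f g df dg z : is_diff z f df -> is_diff z g dg ->
  is_diff z (fun w => f w * g w) (fun h => f z * dg h + g z * df h).
Proof. by move=> ? ?; exact: is_diffM. Qed.

Lemma is_diff_cstf (k : R) z : is_diff z (fun=> k) (fun=> 0).
Proof. exact: is_diff_cst. Qed.

Lemma is_diff_scalef (k : R) f df z : is_diff z f df ->
  is_diff z (fun w => k * f w) (fun h => k * df h).
Proof. by move=> ?; exact: is_diffZ. Qed.

Lemma is_diff_coord i z : is_diff z (fun w : V => w 0 i) (fun h => h 0 i).
Proof.
have @f : {linear V -> R}.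
  by exists (fun N : V => N 0 i); do 2![eexists]; do ?[constructor];
     rewrite ?mxE// => ? *; rewrite ?mxE//; move=> ?; rewrite !mxE.
have cf : continuous f by exact: coord_continuous.
rewrite (_ : (fun _ => _) = f) //; apply: DiffDef.
  exact: linear_differentiable.
by rewrite diff_lin.
Qed.

Lemma is_diff_sumf (I : Type) (r : seq I) (f df : I -> V -> R) z :
  (forall i, is_diff z (f i) (df i)) ->
  is_diff z (fun w => \sum_(i <- r) f i w) (fun h => \sum_(i <- r) df i h).
Proof.
move=> fd; elim: r => [|i r IHr].
  have := is_diff_cstf 0 z; congr is_diff_def;
  by apply/funext => w; rewrite big_nil.
have := is_diff_addf (fd i) IHr; congr is_diff_def;
by apply/funext => w; rewrite big_cons.
Qed.

Lemma is_diff_lnf f df z : 0 < f z -> is_diff z f df ->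
  is_diff z (fun w => ln (f w)) (fun h => (f z)^-1 * df h).
Proof.
move=> f0 fd; have [dl <-] := is_derive1_ln f0.
have dln : is_diff (f z) (@ln R) ( *:%R^~ ('D_1 (@ln R) (f z))).
  apply: DiffDef; first exact/derivable1_diffP.
  by rewrite -derive1E deriv1E.
apply: (is_diff_eq (is_diff_comp fd dln)).
by apply/funext => h /=; rewrite mulrC.
Qed.

Lemma is_diff_invf f df z : f z != 0 -> is_diff z f df ->
  is_diff z (fun w => (f w)^-1) (fun h => - df h / f z ^+ 2).
Proof.
move=> f0 fd; have dfz : differentiable f z by [].
apply: DiffDef; first exact: differentiableV.
rewrite (diffV dfz f0); apply/funext => h /=.
have -> : 'd f z h = df h by have [_ ->] := fd.
by rewrite scaleNr mulNr; congr (- _); exact: mulrC.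
Qed.

Lemma norm_coord_le (i : 'I_N) (w : V) : `|w 0 i| <= `|w|.
Proof.
rewrite [leRHS]/Num.Def.normr/= mx_normrE.
by apply: (le_bigmax _ (fun k => `|w k.1 k.2|) (0, i)).
Qed.

Lemma near_coord (i : 'I_N) z (r : R) : 0 < r ->
  \forall w \near z, `|(w : V) 0 i - z 0 i| < r.
Proof.
move=> r0; near=> w; apply: (@le_lt_trans _ _ `|w - z|).
  by have := norm_coord_le i (w - z); rewrite !mxE.
rewrite distrC; near: w; exact: cvgr_dist_lt.
Unshelve. all: by end_near. Qed.

Lemma is_diff_of_quadratic f z (i j : 'I_N) (a b r C : R) : 0 < r -> 0 <= C ->
  (forall w, `|w 0 i - z 0 i| < r -> `|w 0 j - z 0 j| < r ->
    `|f w - f z - (a * (w 0 i - z 0 i) + b * (w 0 j - z 0 j))|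
      <= C * (`|w 0 i - z 0 i| + `|w 0 j - z 0 j|) ^+ 2) ->
  is_diff z f (fun h => a * h 0 i + b * h 0 j).
Proof.
move=> r0 C0 H.
pose l w := a * w 0 i + b * w 0 j.
have dl : is_diff z l l.
  by apply: is_diff_addf; apply: is_diff_scalef; exact: is_diff_coord.
have d0 : is_diff z (fun w => f w - l w) (fun=> 0).
  (* The factor 4 comes from bounding each of the two coordinates by the sup norm before
     squaring. *)
  apply: (@is_diff0_of_quadratic _ _ _ _ _ (4 * C)); near=> w.
  have -> : f w - l w - (f z - l z) =
      f w - f z - (a * (w 0 i - z 0 i) + b * (w 0 j - z 0 j)).
    by rewrite /l; ring.
  apply: (le_trans (H w _ _)); try by near: w; exact: near_coord.
  rewrite [4 * C]mulrC -mulrA ler_wpM2l//.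
  have -> : 4 * `|w - z| ^+ 2 = (`|w - z| + `|w - z|) ^+ 2 by ring.
  rewrite lerXn2r ?nnegrE ?addr_ge0//.
  by apply: lerD; [have := norm_coord_le i (w - z)|have := norm_coord_le j (w - z)];
    rewrite !mxE.
have := is_diff_addf dl d0; congr is_diff_def.
  by apply/funext => w /=; rewrite subrKC.
by apply/funext => w /=; rewrite addr0.
Unshelve. all: by end_near. Qed.

Lemma near_eq_is_diff f g df z :
  (\forall w \near z, f w = g w) -> is_diff z g df -> is_diff z f df.
Proof.
move=> fg gd; have fgz : f z = g z by exact: nbhs_singleton fg.
have d0 : is_diff z (fun w => f w - g w) (fun=> 0).
  apply: (@is_diff0_of_quadratic _ _ _ _ _ 0); apply: filterS fg => w ->.
  by rewrite fgz !subrr normr0 mul0r.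
have := is_diff_addf gd d0; congr is_diff_def.
  by apply/funext => w /=; rewrite subrKC.
by apply/funext => w /=; rewrite addr0.
Qed.

End differentials.

(* [G w v] stands for the derivative of [F] at [w] along [v], and [B] for the
   Hessian of [F] at [z] as a bilinear form. *)
Definition second_order (R : realType) N (F : 'rV[R]_N -> R) (z : 'rV[R]_N)
    (G B : 'rV[R]_N -> 'rV[R]_N -> R) : Prop :=
  [/\ \forall w \near z, is_diff w F (G w),
      forall v, is_diff z (G^~ v) (B^~ v) &
      forall h v, B h v = B v h].

(** * Calculus of second-order data *)

Section second_order.
Context {R : realType} {N : nat}.
Local Notation V := 'rV[R]_N.
Implicit Types (F : V -> R) (G B : V -> V -> R) (z w : V).

Lemma second_order_cst (k : R) z :
  second_order (fun=> k) z (fun _ _ => 0) (fun _ _ => 0).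
Proof.
split => //; last by move=> v; exact: is_diff_cstf.
by near=> w; exact: is_diff_cstf.
Unshelve. all: by end_near. Qed.

Lemma second_order_add F1 F2 z G1 G2 B1 B2 :
  second_order F1 z G1 B1 -> second_order F2 z G2 B2 ->
  second_order (fun w => F1 w + F2 w) z (fun w v => G1 w v + G2 w v)
    (fun h v => B1 h v + B2 h v).
Proof.
move=> [f1 g1 s1] [f2 g2 s2]; split.
- by near=> w; apply: is_diff_addf; near: w.
- by move=> v; exact: is_diff_addf.
- by move=> h v; rewrite s1 s2.
Unshelve. all: by end_near. Qed.

Lemma second_order_scale (k : R) F z G B : second_order F z G B ->
  second_order (fun w => k * F w) z (fun w v => k * G w v) (fun h v => k * B h v).
Proof.
move=> [f1 g1 s1]; split.
- by near=> w; apply: is_diff_scalef; near: w.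
- by move=> v; exact: is_diff_scalef.
- by move=> h v; rewrite s1.
Unshelve. all: by end_near. Qed.

Lemma second_order_sum (I : Type) (r : seq I) (F : I -> V -> R) z
    (G B : I -> V -> V -> R) :
  (forall i, second_order (F i) z (G i) (B i)) ->
  second_order (fun w => \sum_(i <- r) F i w) z
    (fun w v => \sum_(i <- r) G i w v) (fun h v => \sum_(i <- r) B i h v).
Proof.
move=> H; elim: r => [|i r IHr].
  have := second_order_cst 0 z; congr second_order;
  by do ?[apply/funext => ?]; rewrite big_nil.
have := second_order_add (H i) IHr; congr second_order;
by do ?[apply/funext => ?]; rewrite big_cons.
Qed.

Lemma second_order_affine_sqr (l : V -> R) (k : R) z :
  (forall w, is_diff w l l) ->
  second_order (fun w => (k + l w) ^+ 2) z (fun w v => 2 * (k + l w) * l v)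
    (fun h v => 2 * l h * l v).
Proof.
move=> dl.
have dk w : is_diff w (fun w => k + l w) l.
  apply: (is_diff_eq (is_diff_addf (is_diff_cstf k w) (dl w))).
  by apply/funext => h; rewrite add0r.
split.
- near=> w; apply: (is_diff_eq (is_diff_mulf (dk w) (dk w))).
  by apply/funext => h; ring.
- move=> v; have := is_diff_scalef (2 * l v) (dk z); congr is_diff_def;
  by apply/funext => h; ring.
- by move=> h v; ring.
Unshelve. all: by end_near. Qed.

Lemma second_order_linear (l : V -> R) z :
  (forall w, is_diff w l l) ->
  second_order l z (fun=> l) (fun _ _ => 0).
Proof.
by move=> dl; split => // [|v]; [near=> w|exact: is_diff_cstf].
Unshelve. all: by end_near. Qed.

Lemma second_order_ln F z G B : 0 < F z -> second_order F z G B ->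
  second_order (fun w => ln (F w)) z (fun w v => (F w)^-1 * G w v)
    (fun h v => B h v / F z - G z h * G z v / F z ^+ 2).
Proof.
move=> F0 [f1 g1 s1]; have Fz := nbhs_singleton f1.
have cF : {for z, continuous F} by apply: differentiable_continuous.
split.
- near=> w; apply: is_diff_lnf; last by near: w.
  near: w; have := cvgr_gt (F z) cF 0 F0; exact.
- move=> v; have Fn0 : F z != 0 by rewrite gt_eqF.
  apply: (is_diff_eq (is_diff_mulf (is_diff_invf Fn0 Fz) (g1 v))).
  by apply/funext => h; field.
- by move=> h v; rewrite s1 [G z h * _]mulrC.
Unshelve. all: by end_near. Qed.

(** Gradient entries are [G] along basis vectors near [z], so the Hessian entries are [B] on pairs
    of basis vectors; bilinearity recovers the quadratic form. *)
Lemma second_order_hessian F z G B : second_order F z G B ->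
  [/\ twice_differentiable F z, (hessian F z)^T = hessian F z &
      forall v, (v *m hessian F z *m v^T) 0 0 = B v v].
Proof.
move=> [f1 g1 s1].
have gradE w : is_diff w F (G w) -> gradient F w = \row_i G w (delta_mx 0 i).
  move=> dF; apply/rowP => i; rewrite !mxE deriveE//.
  by have [_ ->] := dF.
have dgrad i : is_diff z (fun w => gradient F w 0 i) (B^~ (delta_mx 0 i)).
  apply: near_eq_is_diff (g1 _).
  by apply: filterS f1 => w /gradE ->; rewrite mxE.
have gradsum : gradient F = \sum_i (fun w => gradient F w 0 i *: delta_mx 0 i).
  apply/funext => w; rewrite fct_sumE.
  by rewrite {1}[gradient F w]row_sum_delta.
have dg : differentiable (gradient F) z.
  rewrite gradsum; apply: differentiable_sum => i.
  apply: differentiableZl; exact: (@ex_diff _ _ _ _ _ _ _ (dgrad i)).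
have dgE v j : ('d (gradient F) z v) 0 j = B v (delta_mx 0 j).
  rewrite -deriveE// derive_mx ?mxE; last exact: diff_derivable.
  by case: (dgrad j) => dj vj; rewrite deriveE// vj.
(* [B] is linear in its first argument as a differential, and in the second by symmetry. *)
have linB u : linear (B^~ u).
  by have [_ <-] := g1 u; exact: linearP.
have sumB v u : B v u = \sum_j u 0 j * B v (delta_mx 0 j).
  rewrite s1; under eq_bigr do rewrite s1.
  pose L := GRing.isLinear.Build _ _ _ _ _ (linB v).
  pose Bl : {linear V -> R} := HB.pack (B^~ v) L.
  transitivity (Bl (\sum_j u 0 j *: delta_mx 0 j)); first by rewrite /= -row_sum_delta.
  rewrite linear_sum.
  by apply: eq_bigr => j _; rewrite linearZ.
split.
- split => //; near=> w.
  by have : is_diff w F (G w) by near: w.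
- by apply/matrixP => i j; rewrite /hessian /jacobian mxE ![lin1_mx _ _ _]mxE !dgE s1.
- move=> v; rewrite /hessian /jacobian mul_rV_lin1 mxE (sumB v v).
  by apply: eq_bigr => j _; rewrite dgE [_^T _ _]mxE mulrC.
Unshelve. all: by end_near. Qed.

End second_order.

(** * The conjugate of the log-partition function *)

Section conjugate.
Context {R : realType} (M : R) (S : set R) (E : (R -> R) -> R).
Hypothesis mE : mean M S E.
Hypothesis three_points : exists a b c, S a /\ S b /\ S c /\
  a <> b /\ a <> c /\ b <> c.
Variable f : R -> R -> R.
(** [f] is prescribed only on the image of the mean map; this suffices for derivatives since that
    map is locally onto. *)
Hypothesis fE : forall a c,
  f (tilted E a c (fun b => b)) (tilted E a c (fun b => b ^+ 2)) =
  a * tilted E a c (fun b => b) + c * tilted E a c (fun b => b ^+ 2)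
    - ln (E (quadexp a c)).

(** The first-order remainder lies between 0 and the pairing of parameter and mean increments, which
    is quadratic because the inverse is Lipschitz at the point. *)
Lemma is_diff_conjugate N (w : 'rV[R]_N) (i j : 'I_N) a c :
  w 0 i = tilted E a c (fun b => b) -> w 0 j = tilted E a c (fun b => b ^+ 2) ->
  is_diff w (fun w => f (w 0 i) (w 0 j)) (fun h => a * h 0 i + c * h 0 j).
Proof.
move=> wi wj; have [r [C [r0 C0 loc]]] := tilted_local_inverse three_points mE a c.
apply: (is_diff_of_quadratic r0 C0) => w'; rewrite wi wj => di dj.
have [a' [c' [ei ej lip _ _]]] := loc _ _ di dj.
have /andP[] := conjugate_squeeze mE a c a' c'.
rewrite -!fE ei ej.
set X := w' 0 i - _ in lip *; set Y := w' 0 j - _ in lip *.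
set Z := f _ _ - f _ _ - _ => Z0 Z1.
rewrite ger0_norm//; apply: (le_trans Z1).
have n1 : (a' - a) * X <= `|a' - a| * `|X| by rewrite -normrM ler_norm.
have n2 : (c' - c) * Y <= `|c' - c| * `|Y| by rewrite -normrM ler_norm.
apply: (@le_trans _ _ ((`|a' - a| + `|c' - c|) * (`|X| + `|Y|))).
  have n3 : 0 <= `|a' - a| * `|Y| by rewrite mulr_ge0.
  have n4 : 0 <= `|c' - c| * `|X| by rewrite mulr_ge0.
  by lra.
by rewrite expr2 mulrA ler_wpM2r// addr_ge0.
Qed.

(** The bilinear form of the inverse covariance matrix, written with the adjugate. *)
Definition conjform (T : (R -> R) -> R) (h1 h2 v1 v2 : R) : R :=
  (cov22 T * (h1 * v1) - cov12 T * (h1 * v2 + h2 * v1) + cov11 T * (h2 * v2))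
    / covdet T.

(** The gradient of the conjugate is a pointwise choice [th] of preimages, whose quadratic error
    makes it differentiable at [z]. *)
Lemma second_order_conjugate N (z : 'rV[R]_N) (i j : 'I_N) a c :
  z 0 i = tilted E a c (fun b => b) -> z 0 j = tilted E a c (fun b => b ^+ 2) ->
  exists G, second_order (fun w => f (w 0 i) (w 0 j)) z G
    (fun h v => conjform (tilted E a c) (h 0 i) (h 0 j) (v 0 i) (v 0 j)).
Proof.
move=> zi zj; have [r [C [r0 C0 loc]]] := tilted_local_inverse three_points mE a c.
set T := tilted E a c in zi zj loc *.
pose P (ms : R * R) (ac : R * R) := [/\ tilted E ac.1 ac.2 (fun b => b) = ms.1,
  tilted E ac.1 ac.2 (fun b => b ^+ 2) = ms.2,
  `|ac.1 - a - (cov22 T * (ms.1 - z 0 i) - cov12 T * (ms.2 - z 0 j)) / covdet T|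
    <= C * (`|ms.1 - z 0 i| + `|ms.2 - z 0 j|) ^+ 2 &
  `|ac.2 - c - (cov11 T * (ms.2 - z 0 j) - cov12 T * (ms.1 - z 0 i)) / covdet T|
    <= C * (`|ms.1 - z 0 i| + `|ms.2 - z 0 j|) ^+ 2].
have [th thP] : exists th : R * R -> R * R, forall ms,
    `|ms.1 - z 0 i| < r -> `|ms.2 - z 0 j| < r -> P ms (th ms).
  have /choice[th thP] : forall ms : R * R, exists ac : R * R,
      `|ms.1 - z 0 i| < r -> `|ms.2 - z 0 j| < r -> P ms ac.
    (* Outside the square the condition is vacuous and [(0, 0)] is a dummy value. *)
    move=> [m s] /=; have [dm|dm] := ltP `|m - z 0 i| r; last by exists (0, 0).
    have [ds|ds] := ltP `|s - z 0 j| r; last by exists (0, 0).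
    rewrite zi in dm; rewrite zj in ds.
    have [a' [c' [e1 e2 _ e3 e4]]] := loc _ _ dm ds.
    by exists (a', c') => _ _; split => //=; rewrite zi zj.
  by exists th.
pose al (w : 'rV[R]_N) : R := (th (w 0 i, w 0 j)).1.
pose be (w : 'rV[R]_N) : R := (th (w 0 i, w 0 j)).2.
(* At the base point the error bounds vanish and force the chosen preimage to be [(a, c)]. *)
have thz : P (z 0 i, z 0 j) (th (z 0 i, z 0 j)).
  by apply: thP; rewrite subrr normr0.
have [_ _] := thz; rewrite /= !subrr !mulr0 subrr mul0r normr0 addr0 !subr0 expr0n/=.
rewrite mulr0 !normr_le0 !subr_eq0 => /eqP alz /eqP bez.
exists (fun w v => al w * v 0 i + be w * v 0 j); split.
- near=> w; apply: is_diff_conjugate.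
    have [] := thP (w 0 i, w 0 j); try by near: w; exact: near_coord.
    by move=> -> _ _ _.
  have [] := thP (w 0 i, w 0 j); try by near: w; exact: near_coord.
  by move=> _ -> _ _.
- move=> v.
  have dal : is_diff z al (fun h => cov22 T / covdet T * h 0 i
      + - (cov12 T / covdet T) * h 0 j).
    apply: (is_diff_of_quadratic r0 C0) => w wi wj.
    have [_ _ + _] := thP (w 0 i, w 0 j) wi wj; rewrite /= /al alz.
    by congr (`|_ - _| <= _); ring.
  have dbe : is_diff z be (fun h => - (cov12 T / covdet T) * h 0 i
      + cov11 T / covdet T * h 0 j).
    apply: (is_diff_of_quadratic r0 C0) => w wi wj.
    have [_ _ _] := thP (w 0 i, w 0 j) wi wj; rewrite /= /be bez.
    by congr (`|_ - _| <= _); ring.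
  have := is_diff_addf (is_diff_scalef (v 0 i) dal) (is_diff_scalef (v 0 j) dbe).
  rewrite (_ : (fun w => _) = fun w => al w * v 0 i + be w * v 0 j); last first.
    by apply/funext => w; rewrite ![v 0 _ * _]mulrC.
  by move/is_diff_eq; apply; apply/funext => h; rewrite /conjform; ring.
- by move=> h v; rewrite /conjform; congr (_ / _); ring.
Unshelve. all: by end_near. Qed.

End conjugate.

(** * Bounds for the inverse covariance form *)

Section conjform_bounds.
Context {R : realType} (M : R) (S : set R) (T : (R -> R) -> R).
Hypothesis mT : mean M S T.
Hypothesis three_points : exists a b c, S a /\ S b /\ S c /\
  a <> b /\ a <> c /\ b <> c.

(** The eigenvalues of the inverse covariance are at least [1 / tr A]; the summand 1 keeps the
    constant positive for every real [M]. *)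
Lemma conjform_ge u v :
  (1 + M ^+ 2 + M ^+ 4)^-1 * (u ^+ 2 + v ^+ 2) <= conjform T u v u v.
Proof.
have d0 := covdet_gt0 mT three_points.
have c1 := cov11_gt0 mT three_points; have c2 := cov22_gt0 mT three_points.
have l1 := cov11_le mT; have l2 := cov22_le mT.
have tr0 : 0 < cov11 T + cov22 T by lra.
apply: (@le_trans _ _ ((cov11 T + cov22 T)^-1 * (u ^+ 2 + v ^+ 2))).
  by rewrite ler_wpM2r ?addr_ge0 ?sqr_ge0// lef_pV2 ?posrE; lra.
rewrite mulrC ler_pdivrMr// /conjform mulrAC ler_pdivlMr//.
rewrite -subr_ge0 (_ : _ - _ = (cov22 T * u - cov12 T * v) ^+ 2
  + (cov12 T * u - cov11 T * v) ^+ 2); first by rewrite addr_ge0 ?sqr_ge0.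
by rewrite /covdet; ring.
Qed.

(* Cauchy-Schwarz between the covariance form and its inverse. *)
Lemma conjform_cauchy u v :
  (v - 2 * T (fun b => b) * u) ^+ 2 <= 4 * M ^+ 2 * cov11 T * conjform T u v u v.
Proof.
have d0 := covdet_gt0 mT three_points.
set m := T (fun b => b).
have q0 : 0 <= conjform T u v u v.
  apply: le_trans (conjform_ge u v).
  rewrite mulr_ge0 ?addr_ge0 ?sqr_ge0// invr_ge0 ?addr_ge0 ?sqr_ge0//.
  by rewrite (exprM M 2 2) sqr_ge0.
apply: le_trans (ler_wpM2r q0 (covq_var_le mT)); rewrite -/m.
rewrite /conjform [_ * (_ / _)]mulrA ler_pdivlMr// -subr_ge0.
(* In dimension two the Cauchy-Schwarz defect times the determinant is a single square. *)
rewrite [leRHS](_ : _ = (cov22 T * u - cov12 T * v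
   + 2 * m * (cov11 T * v - cov12 T * u)) ^+ 2); first exact: sqr_ge0.
by rewrite /covdet /covq; ring.
Qed.

End conjform_bounds.

(** Cauchy-Schwarz without square roots, by induction on the list of indices. *)
Lemma sqr_sum_le (R : realType) (I : Type) (r : seq I) (x t q : I -> R) :
  (forall i, 0 <= t i) -> (forall i, 0 <= q i) ->
  (forall i, x i ^+ 2 <= t i * q i) ->
  (\sum_(i <- r) x i) ^+ 2 <= (\sum_(i <- r) t i) * \sum_(i <- r) q i.
Proof.
move=> t0 q0 xtq; elim: r => [|i r IHr]; first by rewrite !big_nil expr0n mul0r.
rewrite !big_cons; move: IHr.
set X := \sum_(_ <- _) _; set T := \sum_(_ <- _) _; set Q := \sum_(_ <- _) _ => IHr.
have T0 : 0 <= T by exact: sumr_ge0.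
have Q0 : 0 <= Q by exact: sumr_ge0.
(* The cross term follows from [(x X)^2 <= (t q)(T Q)] and [4 (t Q)(T q) <= (t Q + T q)^2]. *)
suff : 2 * (x i * X) <= t i * Q + T * q i.
  by have := xtq i; lra.
have s0 : 0 <= t i * Q + T * q i by rewrite addr_ge0 ?mulr_ge0.
apply: le_trans (ler_norm _) _; rewrite -(ger0_norm s0) -ler_sqr ?nnegrE//.
rewrite !real_normK ?num_real//.
apply: (@le_trans _ _ (4 * ((t i * q i) * (T * Q)))).
  rewrite !exprMn (_ : 2 ^+ 2 = 4 :> R); last by ring.
  by rewrite ler_pM2l// ler_pM ?sqr_ge0.
by have := sqr_ge0 (t i * Q - T * q i); lra.
Qed.

(** * The Hessian of the free energy *)

(* The log-determinant term is the only concave one. Its rank-one part, of size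
   [(c * Y / D) ^+ 2], is not controlled by [rho] alone when [sigma2] is small:
   it has to be absorbed by the entropy part [Q]. *)
Lemma tap_hessian_bound (R : realFieldType) (M k c U W Q T Y : R) :
  let kappa0 := (1 + M ^+ 2 + M ^+ 4)^-1 in let D := 1 + c * T in
  0 <= k -> 0 <= c -> 0 <= T -> 0 <= U -> 0 <= W -> k * c < kappa0 / 4 ->
  kappa0 * (U + W) <= Q -> Y ^+ 2 <= 4 * M ^+ 2 * T * Q ->
  kappa0 / 4 * (U + W) <= Q + k / 2 * (- (2 * c * U) / D - (c * Y) ^+ 2 / D ^+ 2).
Proof.
move=> kappa0 D k0 c0 T0 U0 W0 rho QUW YQ.
have M2 : 0 <= M ^+ 2 by exact: sqr_ge0.
have M4 : 0 <= M ^+ 4 by rewrite (exprM M 2 2) sqr_ge0.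
have d0 : 0 < 1 + M ^+ 2 + M ^+ 4 by lra.
have K0 : 0 < kappa0 by rewrite invr_gt0.
have Mk : M ^+ 2 * kappa0 <= 1 by rewrite ler_pdivrMr// mul1r; lra.
have cT0 : 0 <= c * T by rewrite mulr_ge0.
have D1 : 1 <= D by rewrite lerDl.
have D0 : 0 < D by lra.
have Q0 : 0 <= Q by apply: le_trans QUW; rewrite mulr_ge0 ?addr_ge0// ltW.
have kc0 : 0 <= k * c by rewrite mulr_ge0.
have e1 : k * c * U / D <= kappa0 / 4 * U.
  rewrite ler_pdivrMr//; apply: (@le_trans _ _ (kappa0 / 4 * U)).
    by rewrite ler_wpM2r// ltW.
  by rewrite ler_peMr// mulr_ge0// divr_ge0// ltW.
(* The bound on [Y^2] leaves a factor [c T / D^2 <= 1], so only the product [k * c] has to be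
   small. *)
have e2 : k / 2 * ((c * Y) ^+ 2 / D ^+ 2) <= Q / 2.
  rewrite mulrA ler_pdivrMr ?exprn_gt0//.
  apply: (@le_trans _ _ (2 * (k * c) * (M ^+ 2 * Q) * (c * T))).
    have -> : 2 * (k * c) * (M ^+ 2 * Q) * (c * T) =
        k / 2 * (c ^+ 2 * (4 * M ^+ 2 * T * Q)) by field.
    by rewrite exprMn ler_wpM2l ?divr_ge0// ler_wpM2l ?sqr_ge0.
  have cTD : c * T <= D ^+ 2 by rewrite /D; nra.
  apply: ler_pM => //; first by apply: mulr_ge0; apply: mulr_ge0.
  apply: (@le_trans _ _ (2 * (kappa0 / 4) * (M ^+ 2 * Q))).
    by apply: ler_wpM2r; [exact: mulr_ge0|apply: ler_wpM2l => //; exact: ltW].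
  have -> : 2 * (kappa0 / 4) * (M ^+ 2 * Q) = (M ^+ 2 * kappa0) * (Q / 2) by field.
  by rewrite ler_piMl// divr_ge0.
have e3 : kappa0 * (U + W) = kappa0 * U + kappa0 * W by rewrite mulrDr.
have e4 : 0 <= kappa0 * W by rewrite mulr_ge0// ltW.
have -> : k / 2 * (- (2 * c * U) / D - (c * Y) ^+ 2 / D ^+ 2) =
    - (k * c * U / D) - k / 2 * ((c * Y) ^+ 2 / D ^+ 2).
  by field; rewrite gt_eqF.
(* Half of [Q] is left and gives [kappa0 / 2 * (U + W)], of which [e1] costs at most
   [kappa0 / 4 * U]. *)
by move: QUW e1; lra.
Qed.

(** Deterministic form of the bound, for one design and response: second-order data of the summands
    are assembled and passed to [tap_hessian_bound]. *)
Lemma hessian_FTAP_ge (R : realType) (M : R)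
    (P0 : probability (measurableTypeR R) R) (sigma2 : R) (n p : nat)
    (X : 'M[R]_(n, p)) (y : 'cV[R]_n) (m s : 'rV[R]_p) :
  let kappa := (1 + M ^+ 2 + M ^+ 4)^-1 / 4 in
  0 < sigma2 -> (0 < p)%N ->
  (exists a b c : R, msupport P0 a /\ msupport P0 b /\ msupport P0 c /\
     a <> b /\ a <> c /\ b <> c) ->
  msupport P0 `<=` [set b | - M <= b <= M] ->
  (n%:R / p%:R) / sigma2 < kappa ->
  (forall j : 'I_p, Gamma P0 (m 0 j, s 0 j)) ->
  twice_differentiable (FTAP_joint P0 sigma2 X y) (row_mx m s) /\
  loewner_ge (hessian (FTAP_joint P0 sigma2 X y) (row_mx m s)) kappa%:M.
Proof.
move=> kappa s0 p0 three supp_M rho gam.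
set z := row_mx m s.
have mE := mean_prior supp_M; set E := prior_mean M P0 in mE.
have zl j : z 0 (lshift p j) = m 0 j by rewrite row_mxEl.
have zr j : z 0 (rshift p j) = s 0 j by rewrite row_mxEr.
have /choice[ac acP] : forall j, exists ac : R * R,
    tilted E ac.1 ac.2 (fun b => b) = m 0 j /\
    tilted E ac.1 ac.2 (fun b => b ^+ 2) = s 0 j.
  by move=> j; have /(GammaP supp_M)[a [c H]] := gam j; exists (a, c).
pose f (m s : R) : R := fine (- entropy P0 m s)%E.
pose T j := tilted E (ac j).1 (ac j).2.
have mT j : mean M (msupport P0) (T j) := mean_tilted mE _ _.
pose Bf j (h v : 'rV[R]_(p + p)) := conjform (T j)
  (h 0 (lshift p j)) (h 0 (rshift p j)) (v 0 (lshift p j)) (v 0 (rshift p j)).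
have /choice[Gf sof] : forall j, exists G,
    second_order (fun w : 'rV[R]_(p + p) => f (w 0 (lshift p j)) (w 0 (rshift p j)))
      z G (Bf j).
  move=> j; have [e1 e2] := acP j.
  by apply: (second_order_conjugate mE three (f := f)) => [a c||];
    [exact: entropyE|rewrite zl e1|rewrite zr e2].
pose l i (w : 'rV[R]_(p + p)) := \sum_(k < p) (- X i k) * w 0 (lshift p k).
have dl i w : is_diff w (l i) (l i).
  by apply: is_diff_sumf => k; apply: is_diff_scalef; exact: is_diff_coord.
pose c := (p%:R * sigma2)^-1.
have pR0 : 0 < p%:R :> R by rewrite ltr0n.
have c0 : 0 < c by rewrite invr_gt0 mulr_gt0.
(* Second-order data of the argument of the logarithm, [1 + c * sum_j (s_j - m_j^2)]. *)
have sog := second_order_add (second_order_cst 1 z)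
  (@second_order_sum _ _ _ (index_enum 'I_p) _ z _ _ (fun j =>
    second_order_scale c (second_order_add
      (second_order_linear z (fun w => is_diff_coord (rshift p j) w))
      (second_order_scale (-1) (second_order_affine_sqr 0 z
        (fun w => is_diff_coord (lshift p j) w)))))).
set g := (X in second_order X _ _ _) in sog.
pose tau j := cov11 (T j).
have tau0 j : 0 < tau j := cov11_gt0 (mT j) three.
(* On [Gamma] each [s_j - m_j^2] is a variance, so the logarithm is taken at a point at least 1. *)
have gz : g z = 1 + c * \sum_j tau j.
  rewrite /g mulr_sumr; congr (1 + _); apply: eq_bigr => j _; congr (c * _).
  have [e1 e2] := acP j.
  by rewrite zl zr -e1 -e2 /tau (cov11E (mT j)) add0r mulN1r.
have sT0 : 0 <= \sum_j tau j by apply: sumr_ge0 => j _; exact: ltW.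
have gz0 : 0 < g z by rewrite gz ltr_pwDl// mulr_ge0// ltW.
have so := second_order_add (second_order_add (second_order_add
    (second_order_cst (n%:R / 2 * ln (2 * pi * sigma2)) z)
    (@second_order_sum _ _ _ (index_enum 'I_p) _ z _ _ sof))
    (second_order_scale (1 / (2 * sigma2))
      (@second_order_sum _ _ _ (index_enum 'I_n) _ z _ _
        (fun i => second_order_affine_sqr (y i 0) z (dl i)))))
    (second_order_scale (n%:R / 2) (second_order_ln gz0 sog)).
set F := (X in second_order X _ _ _) in so.
have FE : FTAP_joint P0 sigma2 X y = F.
  apply/funext => w; rewrite /F /FTAP_joint /FTAP; congr (_ + _ + _ * _ + _ * ln _).
  - by rewrite /D0; apply: eq_bigr => j _; rewrite /f !mxE.
  - rewrite /sqnorm2; apply: eq_bigr => i _; congr (_ ^+ 2).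
    rewrite !mxE; congr (_ + _); rewrite -sumrN /l; apply: eq_bigr => k _.
    by rewrite !mxE mulNr.
  - rewrite /g /Smean /Qmean; congr (1 + _).
    rewrite -mulrBr -sumrB mulr_sumr mulr_suml; apply: eq_bigr => j _.
    by rewrite !mxE add0r mulN1r /c invfM mulrAC.
rewrite FE; have [tF symF quadF] := second_order_hessian so.
split => //; split; first by rewrite linearB/= symF tr_scalar_mx.
move=> v; rewrite mulmxBr mulmxBl mul_mx_scalar -scalemxAl !mxE -/z.
have := quadF v; rewrite mxE => ->.
rewrite subr_ge0.
have -> : \sum_j v 0 j * v^T j 0 =
    \sum_j v 0 (lshift p j) ^+ 2 + \sum_j v 0 (rshift p j) ^+ 2.
  by rewrite big_split_ord/=; congr (_ + _); apply: eq_bigr => j _; rewrite mxE expr2.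
set U := \sum_j v 0 (lshift p j) ^+ 2; set W := \sum_j v 0 (rshift p j) ^+ 2.
pose x j := v 0 (rshift p j) - 2 * m 0 j * v 0 (lshift p j).
have U0 : 0 <= U by apply: sumr_ge0 => j _; exact: sqr_ge0.
have W0 : 0 <= W by apply: sumr_ge0 => j _; exact: sqr_ge0.
have rhoE : n%:R * c = n%:R / p%:R / sigma2 by rewrite /c invfM mulrA.
(* Here [k * c] is the ratio [(n / p) / sigma2], [T] the total variance, [Q] the entropy part, and
   [c * Y] the derivative of the argument of the logarithm. *)
have key := @tap_hessian_bound R M n%:R c U W (\sum_j Bf j v v) (\sum_j tau j)
  (\sum_j x j) (ler0n _ n) (ltW c0) sT0 U0 W0.
rewrite rhoE in key; have {}key := key rho.
have QUW : (1 + M ^+ 2 + M ^+ 4)^-1 * (U + W) <= \sum_j Bf j v v.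
  rewrite -big_split/= mulr_sumr; apply: ler_sum => j _.
  exact: (conjform_ge (mT j) three).
have q0 j : 0 <= Bf j v v.
  apply: le_trans (conjform_ge (mT j) three _ _).
  rewrite mulr_ge0 ?addr_ge0 ?sqr_ge0// invr_ge0 ?addr_ge0 ?sqr_ge0//.
  by rewrite (exprM M 2 2) sqr_ge0.
have YQ : (\sum_j x j) ^+ 2 <= 4 * M ^+ 2 * (\sum_j tau j) * \sum_j Bf j v v.
  rewrite [4 * _ * _]mulr_sumr; apply: sqr_sum_le => // j.
    by rewrite mulr_ge0 ?(ltW (tau0 j))// mulr_ge0 ?sqr_ge0.
  have [e1 _] := acP j; rewrite /x -e1.
  exact: (conjform_cauchy (mT j) three).
have {}key := key QUW YQ.
have L0 : 0 <= 1 / (2 * sigma2) * (\sum_(i < n) 2 * l i v * l i v).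
  rewrite mulr_ge0 ?divr_ge0 ?mulr_ge0 ?(ltW s0)//.
  by apply: sumr_ge0 => i _; rewrite -mulrA mulr_ge0// -expr2 sqr_ge0.
have GE : 0 + \sum_j c * (v 0 (rshift p j)
    + -1 * (2 * (0 + z 0 (lshift p j)) * v 0 (lshift p j))) = c * \sum_j x j.
  rewrite add0r mulr_sumr; apply: eq_bigr => j _.
  by rewrite zl add0r mulN1r.
have BE : 0 + \sum_j c * (0 + -1 * (2 * v 0 (lshift p j) * v 0 (lshift p j))) =
    - (2 * c * U).
  rewrite add0r /U mulr_sumr -sumrN; apply: eq_bigr => j _.
  by rewrite add0r; ring.
rewrite GE BE gz; apply: (le_trans key); rewrite add0r -expr2.
(* What remains beyond [key] is the nonnegative least-squares contribution. *)
by rewrite [leRHS]addrAC lerDl.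
Qed.

Theorem mainTheorem3 (R : realType) (M : R) :
  exists kappa c0 : R, 0 < kappa /\ 0 < c0 /\
  forall (P0 : probability (measurableTypeR R) R) (sigma2 : R) (n p : nat)
    (d : measure_display) (T : measurableType d) (P : probability T R)
    (x : 'I_n -> 'I_p -> {RV P >-> R}) (beta0 : 'I_p -> {RV P >-> R})
    (eps : 'I_n -> {RV P >-> R}),
  0 < sigma2 -> (0 < n)%N -> (0 < p)%N ->
  compact (msupport P0) ->
  (exists a b c : R, msupport P0 a /\ msupport P0 b /\ msupport P0 c /\
     a <> b /\ a <> c /\ b <> c) ->
  linear_model P0 sigma2 x beta0 eps ->
  msupport P0 `<=` [set b | - M <= b <= M] ->
  (n%:R / p%:R) / sigma2 < c0 ->
  forall (w : T) (m s : 'rV[R]_p),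
  (forall j : 'I_p, Gamma P0 (m 0 j, s 0 j)) ->
  let F := FTAP_joint P0 sigma2 (design x w) (response x beta0 eps w) in
  twice_differentiable F (row_mx m s) /\
  loewner_ge (hessian F (row_mx m s)) (kappa%:M).
Proof.
have k0 : 0 < (1 + M ^+ 2 + M ^+ 4)^-1 / 4.
  rewrite divr_gt0// invr_gt0 -addrA ltr_pwDl// addr_ge0 ?sqr_ge0//.
  by rewrite (exprM M 2 2) sqr_ge0.
(* A quarter of the entropy lower bound serves both as curvature and as threshold. *)
exists ((1 + M ^+ 2 + M ^+ 4)^-1 / 4), ((1 + M ^+ 2 + M ^+ 4)^-1 / 4).
split=> //; split=> // P0 sigma2 n p d T P x beta0 eps s0 _ p0 _ three _ supp_M rho.
by move=> w m s gam F; exact: hessian_FTAP_ge.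
Qed.
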